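(* (i) There is $n_0$ such that for all $n\ge n_0$, $\mathrm{ex}_3(n,\text{Berge-}B_2)=\lfloor n^2/8\rfloor$. (ii) For every integer $t\ge 3$ there is $n_0(t)$ such that for all $n\ge n_0(t)$, $\mathrm{ex}_3(n,\text{Berge-}B_t)=\lfloor n^2/8\rfloor+(t-1)^2$.
   Context: For a graph $F$ and a hypergraph $\mathcal H$, $\mathcal H$ contains a Berge copy of $F$ (a Berge-$F$) if there is an injection $\varphi:V(F)\to V(\mathcal H)$ and an injection $f:E(F)\to E(\mathcal H)$ such that for every edge $xy\in E(F)$, $\{\varphi(x),\varphi(y)\}\subseteq f(xy)$. A hypergraph is Berge-$F$-free if it contains no Berge-$F$. For integers $r\ge 2$, $n$, $\mathrm{ex}_r(n,\text{Berge-}F)$ denotes the maximum number of hyperedges in an $r$-uniform hypergraph on $n$ vertices (hyperedges are distinct $r$-element subsets) that is Berge-$F$-free. The book graph $B_t$ has vertices $u,v,w_1,\dots,w_t$ and edges $uv$, $uw_i$, $vw_i$ for $1\le i\le t$ (i.e. $t$ triangles sharing the edge $uv$). *)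

(* Defs.v *)
From mathcomp Require Import all_boot.
Set Implicit Arguments. Unset Strict Implicit. Unset Printing Implicit Defensive.

(* A simple graph F on a finite vertex type V is given by its edge set,
   a set of 2-element subsets of V.  A hypergraph on n vertices is a set of
   subsets of 'I_n (hyperedges are distinct by construction). *)

(* H contains a Berge copy of the graph with edge set EF (on vertices V):
   an injection phi : V -> 'I_n and a map f from edges of F to hyperedges of H,
   injective on E(F), with phi(e) contained in f(e) for every edge e.
   Boolean (finite quantification) so that it can be used in \max. *)
Definition berge_contains (V : finType) (EF : {set {set V}}) (n : nat)
    (H : {set {set 'I_n}}) : bool :=
  [exists phi : {ffun V -> 'I_n}, exists f : {ffun {set V} -> {set 'I_n}},
    [&& injectiveb phi,
        [forall e1 in EF, forall e2 in EF, (f e1 == f e2) ==> (e1 == e2)] &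
        [forall e in EF, (f e \in H) && (phi @: e \subset f e)]]].

Definition uniform (n r : nat) (H : {set {set 'I_n}}) : bool :=
  [forall e in H, #|e| == r].

Definition ex_berge (r n : nat) (V : finType) (EF : {set {set V}}) : nat :=
  \max_(H : {set {set 'I_n}} | uniform r H && ~~ berge_contains EF H)
     #|H|.

(* Book graph B_t: u = None, v = Some None, w_i = Some (Some i). *)
Definition book_V (t : nat) : finType := option (option 'I_t).

Definition book_E (t : nat) : {set {set book_V t}} :=
  [set [set (None : book_V t); Some None]] :|:
  [set [set (None : book_V t); Some (Some i)] | i : 'I_t] :|:
  [set [set (Some None : book_V t); Some (Some i)] | i : 'I_t].

(* Main.v *)
(* Call a pair of vertices private if it lies in exactly one hyperedge.  In a
   hypergraph without a Berge book, the common neighbours [w] of an adjacent pair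
   [uv] that are not "leaves" ([uvw] a hyperedge with [uw], [vw] private) are
   at most 3t, since any 3t + 1 of them contain the pages of a Berge book.
   Hence hyperedges without two private pairs span a graph each of whose edges
   lies in boundedly many triangles, and the Ruzsa-Szemeredi argument shows that
   there are only o(n^2) of them.  So if there are at least n^2/8 hyperedges, the
   shadow has almost n^2/4 edges, and Mantel's argument shows that it is close to
   a balanced complete bipartite graph.  Inside each side the well connected
   vertices then only form a matching, and every hyperedge covers two cross pairs.
   A cross pair lying in two hyperedges comes from a block formed by a matched
   pair of either side; each such block gives pages on both of these pairs, so at
   most (t-1)^2 hyperedges are gained over half the number of cross pairs.  For
   the lower bound, one side is perfectly matched, t-1 pairs are matched in the
   other one, and t-1 pairs on either side span blocks with three hyperedges. *)
Require Import Defs.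
From mathcomp Require Import all_boot.
From mathcomp Require Import all_order all_algebra.
From mathcomp Require Import zify ring lra.
Set Implicit Arguments.
Unset Strict Implicit.
Unset Printing Implicit Defensive.
Import Order.TTheory GRing.Theory Num.Theory.

(** * Conditional expectations over a finite partition *)

(** An exact bound tolerates no error term, so every irregularity has to pay for itself. Adjacent
    vertices may have unboundedly many common neighbours, but all except 3t are leaves, and the leaf
    sets of the edges at one vertex are disjoint; this splitting drives almost every count. A poor
    vertex misses more than n/100 of each core of the bipartition and loses that many cross pairs.
    Its gain is only O(t n/Q) for large n, where n/Q bounds the defects of the cores, so Q
    proportional to t makes the loss prevail. Among full vertices, cross pairs in two hyperedges
    then compete with nonadjacent cross pairs. If both sides have more than t-1 matched pairs, the
    nonadjacent ones are at least as many; for t = 2 this always holds, which is why the gain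
    (t-1)^2 is absent there. The triangle bound does without a full regularity lemma: bounded
    codegree leaves few edges inside a neighbourhood, so a triangle in large dense parts itself
    exhibits an irregular pair, and refining there raises a bounded energy. *)

Section ConditionalExpectation.
Local Open Scope ring_scope.
Variables (R : realFieldType) (W : finType) (e : W -> R).

(** A partition is given by a labelling [k]. For vertex pairs labelled by their two colours and [e]
    the edge indicator, this is the density between two parts. *)
Definition condexp (L : finType) (k : W -> L) (w : W) : R :=
  (\sum_(w' | k w' == k w) e w') / #|[pred w' | k w' == k w]|%:R.

Lemma condexp_const (L : finType) (k : W -> L) w w' :
  k w = k w' -> condexp k w = condexp k w'.
Proof. by rewrite /condexp => ->. Qed.

(** Averaging over parts is the orthogonal projection onto the functions constant on parts: after
    exchanging the sums, the number of terms for each [w'] cancels the denominator. *)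
Lemma sum_condexp_mul (L : finType) (k : W -> L) (phi : W -> R) :
  (forall w w', k w = k w' -> phi w = phi w') ->
  \sum_w condexp k w * phi w = \sum_w e w * phi w.
Proof.
move=> phiP.
transitivity (\sum_w \sum_(w' | k w' == k w)
   e w' * (phi w' / #|[pred z | k z == k w']|%:R)).
  apply: eq_bigr => w _; rewrite /condexp -mulrA mulr_suml.
  apply: eq_bigr => w' /eqP kw; by rewrite (phiP _ _ kw) kw [phi w * _]mulrC.
rewrite (exchange_big_dep xpredT) //=; apply: eq_bigr => w' _.
rewrite (eq_bigl (fun w => k w == k w')); last by move=> w; rewrite eq_sym.
rewrite sumr_const -[LHS]mulr_natr -!mulrA; congr (_ * _).
rewrite mulVf ?mulr1 // pnatr_eq0 -lt0n; apply/card_gt0P.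
by exists w'; rewrite inE.
Qed.

(** Pythagoras: the coarse average is constant on the finer parts, so the cross term is the coarse
    energy. *)
Lemma condexp_refine (L L' : finType) (k : W -> L) (k' : W -> L') :
  (forall w w', k' w = k' w' -> k w = k w') ->
  \sum_w (condexp k' w - condexp k w) ^+ 2 =
  \sum_w condexp k' w ^+ 2 - \sum_w condexp k w ^+ 2.
Proof.
move=> ref.
have -> : \sum_w (condexp k' w - condexp k w) ^+ 2 =
    \sum_w condexp k' w ^+ 2 - \sum_w condexp k' w * condexp k w *+ 2
    + \sum_w condexp k w ^+ 2.
  rewrite -sumrB -big_split /=; apply: eq_bigr => w _; ring.
have cross : \sum_w condexp k' w * condexp k w = \sum_w condexp k w ^+ 2.
  rewrite sum_condexp_mul; last by move=> w w' /ref; apply: condexp_const.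
  under [RHS]eq_bigr do rewrite expr2.
  by rewrite sum_condexp_mul // => w w'; apply: condexp_const.
rewrite sumrMnl cross; ring.
Qed.

Lemma sum_condexp_set (L : finType) (k : W -> L) (S : {set W}) :
  (forall w w', k w = k w' -> (w \in S) = (w' \in S)) ->
  \sum_(w in S) condexp k w = \sum_(w in S) e w.
Proof.
move=> SP; rewrite !(big_mkcond (mem S)) /=.
transitivity (\sum_w condexp k w * (w \in S)%:R).
  by apply: eq_bigr => w _; case: (w \in S); rewrite (mulr1, mulr0).
rewrite sum_condexp_mul; last by move=> w w' /SP ->.
by apply: eq_bigr => w _; case: (w \in S); rewrite (mulr1, mulr0).
Qed.

Lemma condexp_ge0 (L : finType) (k : W -> L) w :
  (forall w, 0 <= e w) -> 0 <= condexp k w.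
Proof. by move=> e0; rewrite divr_ge0 ?sumr_ge0 // => i _; exact: e0. Qed.

Lemma condexp_le1 (L : finType) (k : W -> L) w :
  (forall w, e w <= 1) -> condexp k w <= 1.
Proof.
move=> e1; rewrite ler_pdivrMr.
  rewrite mul1r -sum1_card natr_sum; apply: ler_sum => i _; exact: e1.
by rewrite ltr0n; apply/card_gt0P; exists w; rewrite inE.
Qed.

End ConditionalExpectation.

(** * Graphs in which every edge lies in few triangles *)

Lemma leq_card_fibers (X Y : finType) (A : {set X}) (S : {set Y}) (f : X -> Y) C :
  (forall x, x \in A -> f x \in S) ->
  (forall y, y \in S -> #|[set x in A | f x == y]| <= C) ->
  #|A| <= C * #|S|.
Proof.
move=> AS fibC; rewrite -sum1_card (partition_big f (mem S)) //=.
rewrite mulnC -sum_nat_const; apply: leq_sum => y yS.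
apply: leq_trans (fibC y yS); rewrite -sum1_card.
by apply: eq_leq; apply: eq_bigl => x; rewrite !inE.
Qed.

Section SparseParts.
Local Open Scope ring_scope.
Variables (R : realFieldType) (W L : finType) (k : W -> L).

(** A part in which [S] is too thin contributes fewer than [a] times its size, any other part
    nothing. *)
Lemma card_sparse_parts (S : {set W}) (a : R) : 0 <= a ->
  #|[set w in S | #|[set z in S | k z == k w]|%:R
                  < a * #|[pred z | k z == k w]|%:R]|%:R <= a * #|W|%:R.
Proof.
move=> a0; set B := [set w in S | _].
rewrite -sum1_card (partition_big k xpredT) //= natr_sum.
rewrite -[#|W|]sum1_card (partition_big k xpredT) //= natr_sum mulr_sumr.
apply: ler_sum => i _; rewrite !sum1_card.
case: (pickP [pred w in B | k w == i]) => [w /= /andP[wB /eqP kw]|noB]; last first.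
  by rewrite eq_card0 ?mulr_ge0.
move: wB; rewrite inE kw => /andP[_ /ltW]; apply: le_trans.
rewrite ler_nat; apply: subset_leq_card; apply/subsetP => z.
by case/andP; rewrite !inE => /andP[-> _] ->.
Qed.

Lemma card_small_parts (a : R) : 0 <= a ->
  #|[set w | #|[pred z | k z == k w]|%:R * #|L|%:R < a * #|W|%:R]|%:R
  <= a * #|W|%:R.
Proof.
move=> a0; set B := [set w | _].
case: (posnP #|L|) => [L0|Lgt0].
  rewrite eq_card0 ?mulr_ge0 // => w; have := fintype0 (k w); by rewrite L0.
rewrite -(ler_pM2r (_ : 0 < #|L|%:R)) ?ltr0n //.
have -> : a * #|W|%:R * #|L|%:R = \sum_(i : L) a * #|W|%:R.
  by rewrite sumr_const -[RHS]mulr_natr.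
rewrite -[#|B|]sum1_card (partition_big k xpredT) //=.
rewrite natr_sum mulr_suml; apply: ler_sum => i _; rewrite sum1_card.
case: (pickP [pred w in B | k w == i]) => [w /= /andP[wB /eqP kw]|noB]; last first.
  by rewrite eq_card0 ?mul0r ?mulr_ge0.
move: wB; rewrite inE kw => /ltW; apply: le_trans.
rewrite ler_wpM2r // ler_nat.
apply: subset_leq_card; apply/subsetP => z.
by case/andP; rewrite !inE.
Qed.
End SparseParts.

(** [X], [Y] are the sizes of two parts, [M], [N] those of neighbourhoods inside them, [k] the
    number of parts, [e] the edges between the neighbourhoods. As MN is at least a^2 XY, hence at
    least a^4 n^2 / k^2, the bound Cn on [e] is at most (a/2)MN, half of what density [a]
    predicts. *)
Lemma increment_bound (R : realFieldType) (a X Y M N k e d n C : R) :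
  (0 < a -> 0 < k -> 0 <= X -> 0 <= Y -> 0 <= n ->
  a * X <= M -> a * Y <= N -> a <= d -> a * n <= X * k -> a * n <= Y * k ->
  2 * C * k ^+ 2 <= a ^+ 5 * n -> e <= C * n ->
  a ^+ 4 / 4 * (X * Y) <= a * (d * (M * N) - e) - a ^+ 2 / 4 * (M * N))%R.
Proof.
move=> a0 k0 X0 Y0 n0 XM YN ad nX nY kC eC.
have MN : (a ^+ 2 * (X * Y) <= M * N)%R.
  have -> : (a ^+ 2 * (X * Y) = (a * X) * (a * Y))%R by ring.
  by apply: ler_pM; rewrite ?mulr_ge0 // ltW.
have nn : ((a * n) ^+ 2 <= X * Y * k ^+ 2)%R.
  have -> : (X * Y * k ^+ 2 = (X * k) * (Y * k))%R by ring.
  by rewrite expr2; apply: ler_pM; rewrite ?mulr_ge0 // ltW.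
have MN0 : (0 <= M * N)%R.
  by apply: le_trans MN; rewrite !mulr_ge0 ?exprn_ge0 // ltW.
have eMN : (e <= a / 2 * (M * N))%R.
  rewrite -(ler_pM2r (_ : 0 < k ^+ 2)%R) ?exprn_gt0 //.
  have h1 : (e * k ^+ 2 <= C * n * k ^+ 2)%R by rewrite ler_wpM2r ?exprn_ge0 // ltW.
  have h2 : (2 * C * k ^+ 2 * n <= a ^+ 5 * n * n)%R by rewrite ler_wpM2r.
  have h3 : (a ^+ 3 * ((a * n) ^+ 2) <= a ^+ 3 * (X * Y * k ^+ 2))%R.
    by rewrite ler_wpM2l ?exprn_ge0 // ltW.
  have h4 : (a * k ^+ 2 * (a ^+ 2 * (X * Y)) <= a * k ^+ 2 * (M * N))%R.
    by rewrite ler_wpM2l // mulr_ge0 ?exprn_ge0 // ltW.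
  lra.
have h1 : (a * e <= a * (a / 2 * (M * N)))%R by rewrite ler_wpM2l // ltW.
have h2 : (a * a * (M * N) <= a * d * (M * N))%R.
  by rewrite ler_wpM2r // ler_wpM2l // ltW.
have h3 : (a ^+ 2 * (a ^+ 2 * (X * Y)) <= a ^+ 2 * (M * N))%R.
  by rewrite ler_wpM2l ?exprn_ge0 // ltW.
lra.
Qed.

(** * Density energy of a colouring and its increment *)

Section EnergyIncrement.
Local Open Scope ring_scope.
Variables (R : realFieldType) (V : finType) (E : rel V) (C : nat).
Hypothesis codegE : forall x y, E x y -> (#|[set z | E x z && E y z]| <= C)%N.
Hypothesis symE : symmetric E.

Definition edges : {set V * V} := [set p | E p.1 p.2].
Definition triangles : {set V * V * V} :=
  [set p | [&& E p.1.1 p.1.2, E p.1.1 p.2 & E p.1.2 p.2]].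

(** [f] selects an edge of the triangle and [g] its third vertex, a common neighbour of that
    edge. *)
Lemma card_triangles_over (f : V * V * V -> V * V) (g : V * V * V -> V)
    (S : {set V * V}) :
  (forall p, p \in triangles ->
     [/\ E (f p).1 (f p).2, E (f p).1 (g p) & E (f p).2 (g p)]) ->
  injective (fun p => (f p, g p)) ->
  (#|[set p in triangles | f p \in S]| <= C * #|S|)%N.
Proof.
move=> fgP fg_inj; apply: (leq_card_fibers (f := f)) => [p|y _].
  by rewrite inE => /andP[].
set F := [set _ in _ | _].
case: (set_0Vmem F) => [->|[p0]]; first by rewrite cards0.
rewrite !inE => /andP[/andP[p0T _] /eqP fp0].
have [Ey _ _] := fgP p0 ltac:(by rewrite inE).
rewrite fp0 in Ey; apply: leq_trans (codegE Ey).
have gI : {in F &, injective g}.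
  move=> p q; rewrite !inE => /andP[_ /eqP fp] /andP[_ /eqP fq] gpq.
  by apply: fg_inj; rewrite /= fp fq gpq.
rewrite -(card_in_imset gI); apply: subset_leq_card.
apply/subsetP => z /imsetP[p pF ->]; move: pF; rewrite !inE.
move=> /andP[/andP[pT _] /eqP fp].
have [_] := fgP p ltac:(by rewrite inE).
by rewrite fp => -> ->.
Qed.

Lemma card_triangles_over1 (S : {set V * V}) :
  (#|[set p in triangles | p.1 \in S]| <= C * #|S|)%N.
Proof.
apply: (card_triangles_over (f := fst) (g := snd)) => [[[v x] y]|[a b] [c d] /= [-> ->] //].
by rewrite inE => /and3P[].
Qed.

Lemma card_triangles_over2 (S : {set V * V}) :
  (#|[set p in triangles | (p.1.1, p.2) \in S]| <= C * #|S|)%N.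
Proof.
apply: (card_triangles_over (f := fun p => (p.1.1, p.2)) (g := fun p => p.1.2)).
  by case=> [[v x] y]; rewrite inE => /and3P[/= Evx Evy Exy]; split=> //=; rewrite symE.
by case=> [[a b] c] [[a' b'] c'] /= [-> -> ->].
Qed.

Lemma card_triangles_over3 (S : {set V * V}) :
  (#|[set p in triangles | (p.1.2, p.2) \in S]| <= C * #|S|)%N.
Proof.
apply: (card_triangles_over (f := fun p => (p.1.2, p.2)) (g := fun p => p.1.1)).
  case=> [[v x] y]; rewrite inE => /and3P[/= Evx Evy Exy].
  by split=> //=; rewrite symE.
by case=> [[a b] c] [[a' b'] c'] /= [-> -> ->].
Qed.

Section Colouring.
Variables (K : finType) (c : V -> K).

Definition dens (p : V * V) : R :=
  condexp (fun p => (E p.1 p.2)%:R) (fun p => (c p.1, c p.2)) p.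

Definition energy : R := \sum_p dens p ^+ 2.

Definition part (x : V) : {set V} := [set z | c z == c x].
Definition nbr_in (v x : V) : {set V} := [set z in part x | E v z].

(** The roles in the triangle (v, x, y) are unequal: only the parts of [x] and [y] matter, and [v]
    enters through its neighbourhoods in them. *)
Definition clean (a : R) (p : V * V * V) : bool :=
  [&& a * #|part p.1.2|%:R <= #|nbr_in p.1.1 p.1.2|%:R,
      a * #|part p.2|%:R <= #|nbr_in p.1.1 p.2|%:R,
      a <= dens (p.1.2, p.2),
      a * #|V|%:R <= #|part p.1.2|%:R * #|K|%:R
    & a * #|V|%:R <= #|part p.2|%:R * #|K|%:R].

Lemma energy_le : energy <= #|V|%:R ^+ 2.
Proof.
rewrite expr2 -natrM -card_prod -sum1_card natr_sum; apply: ler_sum => p _.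
rewrite expr_le1 ?condexp_le1 ?condexp_ge0 // => q; case: (E _ _) => //=.
Qed.

Lemma energy_ge0 : 0 <= energy.
Proof. by apply: sumr_ge0 => p _; exact: sqr_ge0. Qed.

Lemma dens_cell p :
  dens p = #|[set z in edges | (c z.1, c z.2) == (c p.1, c p.2)]|%:R
           / #|[pred z | (c z.1, c z.2) == (c p.1, c p.2)]|%:R.
Proof.
rewrite /dens /condexp -sum1_card natr_sum; congr (_ / _).
rewrite [LHS]big_mkcond [RHS]big_mkcond; apply: eq_bigr => z _ /=.
by rewrite !inE; case: (E _ _); case: (_ == _).
Qed.

Lemma card_pair_pred (P Q : pred V) :
  #|[pred z : V * V | P z.1 && Q z.2]| = (#|P| * #|Q|)%N.
Proof. by rewrite -cardX; apply: eq_card => z; rewrite !inE. Qed.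

Lemma card_cell p : #|[pred z : V * V | (c z.1, c z.2) == (c p.1, c p.2)]|
  = (#|part p.1| * #|part p.2|)%N.
Proof.
rewrite !cardsE -card_pair_pred; apply: eq_card => z.
by rewrite !inE xpair_eqE.
Qed.

Lemma part_gt0 x : (0 < #|part x|)%N.
Proof. by apply/card_gt0P; exists x; rewrite inE. Qed.

(** Each of the five ways to fail places one pair of the triangle in a set of at most a n^2 pairs,
    and an edge lies in at most [C] triangles. *)
Lemma card_clean (a : R) : 0 <= a ->
  #|triangles|%:R <= #|[set p in triangles | clean a p]|%:R
                     + 5 * C%:R * a * #|V|%:R ^+ 2.
Proof.
move=> a0; set n := #|V|%:R; set T0 := [set p in triangles | clean a p].
pose poor : {set V * V} := [set p in edges |
  #|nbr_in p.1 p.2|%:R < a * #|part p.2|%:R].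
pose thin : {set V * V} := [set p in edges | dens p < a].
pose small : {set V} := [set x | #|part x|%:R * #|K|%:R < a * n].
pose small1 : {set V * V} := setX small setT.
pose small2 : {set V * V} := setX setT small.
have n0 : 0 <= n by rewrite ler0n.
have poor_le : #|poor|%:R <= a * n ^+ 2.
  rewrite -sum1_card natr_sum (partition_big fst xpredT) //=.
  rewrite (_ : a * n ^+ 2 = \sum_(v : V) a * n); last first.
    by rewrite sumr_const -[RHS]mulr_natr -mulrA expr2.
  apply: ler_sum => v _; rewrite -natr_sum sum1_card.
  have := card_sparse_parts c [set z | E v z] a0; apply: le_trans.
  rewrite ler_nat.
  have injs : {in [pred p in poor | p.1 == v] &, injective (@snd V V)}.
    by move=> [? ?] [? ?] /= /andP[_ /eqP/= ->] /andP[_ /eqP/= ->] ->.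
  rewrite -(card_in_image injs); apply: subset_leq_card.
  apply/subsetP => x /imageP[[u y] /andP[+ /= /eqP uv] ->] /=.
  rewrite !inE uv /= => /andP[-> ] /=.
  have -> : #|[set z in [set z | E v z] | c z == c y]| = #|nbr_in v y|.
    by apply: eq_card => z; rewrite !inE andbC.
  by rewrite [#|part y|]cardsE.
have thin_le : #|thin|%:R <= a * n ^+ 2.
  have := card_sparse_parts (fun p : V * V => (c p.1, c p.2)) edges a0.
  rewrite card_prod natrM expr2; apply: le_trans; rewrite ler_nat.
  apply: subset_leq_card; apply/subsetP => p; rewrite !inE => /andP[->] /=.
  rewrite dens_cell ltr_pdivrMr // ltr0n card_cell.
  by rewrite muln_gt0 !part_gt0.
have small_le : #|small|%:R <= a * n.
  have := card_small_parts c a0; apply: le_trans; rewrite ler_nat.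
  by apply: subset_leq_card; apply/subsetP => x; rewrite !inE [#|part x|]cardsE.
have small1_le : #|small1|%:R <= a * n ^+ 2.
  by rewrite cardsX cardsT natrM expr2 mulrA ler_wpM2r.
have small2_le : #|small2|%:R <= a * n ^+ 2.
  by rewrite cardsX cardsT natrM mulrC expr2 mulrA ler_wpM2r.
have cov : triangles \subset T0
   :|: [set p in triangles | p.1 \in poor]
   :|: [set p in triangles | (p.1.1, p.2) \in poor]
   :|: [set p in triangles | (p.1.2, p.2) \in thin]
   :|: [set p in triangles | (p.1.2, p.2) \in small1]
   :|: [set p in triangles | (p.1.2, p.2) \in small2].
  apply/subsetP => -[[v x] y]; rewrite !inE /clean /= => /and3P[-> -> ->] /=.
  by rewrite !leNgt; do !case: (_ < _).
have bound (S : {set V * V}) (m : nat) : (m <= C * #|S|)%N ->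
    #|S|%:R <= a * n ^+ 2 -> m%:R <= C%:R * (a * n ^+ 2).
  move=> mC SC; apply: (@le_trans _ _ (C * #|S|)%:R); first by rewrite ler_nat.
  by rewrite natrM ler_wpM2l.
have b1 := bound _ _ (card_triangles_over1 poor) poor_le.
have b2 := bound _ _ (card_triangles_over2 poor) poor_le.
have b3 := bound _ _ (card_triangles_over3 thin) thin_le.
have b4 := bound _ _ (card_triangles_over3 small1) small1_le.
have b5 := bound _ _ (card_triangles_over3 small2) small2_le.
have := subset_leq_card cov; rewrite -(ler_nat R) => /le_trans; apply.
have U (A B : {set V * V * V}) : #|A :|: B|%:R <= #|A|%:R + #|B|%:R :> R.
  by rewrite -natrD ler_nat leq_card_setU.
do 5! (apply: le_trans (U _ _) _; rewrite -lerBrDr).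
by lra.
Qed.

End Colouring.

(* A clean triangle [vxy] makes the pair of parts of [x] and [y] irregular: it has
   density at least [a], but the large sets of neighbours of [v] in these parts
   span few edges, each giving a triangle with [v]. *)
Lemma energy_increment (K : finType) (c : V -> K) (a : R) :
  0 < a -> 2 * C%:R * #|K|%:R ^+ 2 <= a ^+ 5 * #|V|%:R ->
  exists (K' : finType) (c' : V -> K'),
    #|K'| = (#|K| * (2 ^ (#|K| * #|K|) * 2 ^ (#|K| * #|K|)))%N /\
    a ^+ 4 / 4 * #|[set p in triangles | clean c a p]|%:R
      <= C%:R * (energy c' - energy c).
Proof.
move=> a0 nK; pose n : R := #|V|%:R; set T0 := [set p in triangles | clean c a p].
pose kk (q : V * V) := (c q.1, c q.2).
(* One clean triangle per pair of colours suffices, as it makes the whole pair of parts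
   irregular. *)
pose wit (ij : K * K) := [pick p in T0 | (c p.1.2, c p.2) == ij].
pose A ij := if wit ij is Some p then nbr_in c p.1.1 p.1.2 else set0.
pose B ij := if wit ij is Some p then nbr_in c p.1.1 p.2 else set0.
pose Wt := [set ij | wit ij].
pose K' : finType := (K * ({set K * K} * {set K * K}))%type.
(* Membership in both chosen neighbourhoods is recorded for every pair of colours, so all irregular
   pairs are refined at once. *)
pose c' x : K' := (c x, ([set ij | x \in A ij], [set ij | x \in B ij])).
have card2 : #|{: {set K * K}}| = (2 ^ (#|K| * #|K|))%N.
  by have := card_powerset [set: K * K]; rewrite powersetT !cardsT card_prod.
exists K', c'; split; first by rewrite !card_prod card2.
pose kk' (q : V * V) := (c' q.1, c' q.2).
pose cell ij : {set V * V} := [set q | kk q == ij].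
pose D q := (dens c' q - dens c q) ^+ 2.
have D0 q : 0 <= D q by exact: sqr_ge0.
have -> : energy c' - energy c = \sum_q D q.
  rewrite /D /energy /dens (@condexp_refine R _ _ _ _ kk kk') //.
  by move=> [x y] [x' y']; rewrite /kk /kk' /c' /= => -[-> _ _ -> _ _].
have witP ij p : wit ij = Some p -> p \in T0 /\ (c p.1.2, c p.2) = ij.
  by rewrite /wit; case: pickP => // q /andP[qT /eqP <-] [<-].
have step ij : ij \in Wt ->
    a ^+ 4 / 4 * #|cell ij|%:R <= \sum_(q in setX (A ij) (B ij)) D q.
  rewrite inE; case wij: (wit ij) => [[[v x] y]|//] _.
  have [] := witP _ _ wij; rewrite inE => /andP[pT cl] /= cxy.
  have [dx dy dxy bx byy] := and5P cl; rewrite /= in dx dy dxy bx byy.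
  have eA : A ij = nbr_in c v x by rewrite /A wij.
  have eB : B ij = nbr_in c v y by rewrite /B wij.
  have ecell : #|cell ij| = (#|part c x| * #|part c y|)%N.
    rewrite -(card_cell c (x, y)) cardsE; apply: eq_card => q.
    by rewrite !inE -cxy.
  set S := setX (A ij) (B ij).
  (* [A ij] and [B ij] are unions of new parts, so averaging preserves the edge count on their
     product. *)
  have SE : \sum_(q in S) dens c' q = #|[set q in S | E q.1 q.2]|%:R.
    rewrite /dens (@sum_condexp_set _ _ _ _ _ S) => [|[x1 y1] [x2 y2]].
      rewrite -sum1_card natr_sum big_mkcond [RHS]big_mkcond; apply: eq_bigr => q _ /=.
      by rewrite !inE; case: (E _ _); case: (_ && _).
    rewrite /c' /= => -[_ /setP/(_ ij) hA _ _ _ /setP/(_ ij) hB].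
    by move: hA hB; rewrite !inE => -> ->.
  (* An edge zw from the first neighbourhood to the second makes [w] a common neighbour of [v] and
     [z]. *)
  have SEle : #|[set q in S | E q.1 q.2]|%:R <= C%:R * n.
    rewrite -natrM ler_nat.
    have := @leq_card_fibers _ _ [set q in S | E q.1 q.2] [set z | E v z] fst C.
    move/(_ _ _)/leq_trans; apply.
    - by move=> [z w]; rewrite !inE eA eB !inE /= => /andP[/andP[/andP[_ ->]]].
    - move=> z; rewrite inE => Evz; apply: leq_trans (codegE Evz).
      have inj : {in [set q in [set q in S | E q.1 q.2] | q.1 == z] &,
                    injective (@snd V V)}.
        move=> [? ?] [? ?]; rewrite !inE /= => /andP[_ /eqP ->] /andP[_ /eqP ->].
        by move=> ->.
      rewrite -(card_in_imset inj); apply: subset_leq_card.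
      apply/subsetP => w /imsetP[[z1 w1] + ->]; rewrite !inE eA eB !inE /=.
      by move=> /andP[/andP[/andP[_ /andP[_ ->]] +] /eqP zz]; rewrite zz.
    - by rewrite leq_mul2l max_card orbT.
  have Sc q : q \in S -> dens c q = dens c (x, y).
    case: q => z w; rewrite !inE eA eB !inE /= => /andP[/andP[/eqP cz _]].
    move=> /andP[/eqP cw _]; apply: condexp_const; by rewrite /= cz cw.
  have cS : #|S|%:R = #|nbr_in c v x|%:R * #|nbr_in c v y|%:R :> R.
    by rewrite cardsX eA eB natrM.
  (* Completing the square: u^2 is at least au - a^2/4 for the drop u in density, so only sums of
     densities are needed. *)
  have Sum : \sum_(q in S) (a * (dens c q - dens c' q) - a ^+ 2 / 4)
             <= \sum_(q in S) D q.
    apply: ler_sum => q _; rewrite /D.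
    have := sqr_ge0 (dens c q - dens c' q - a / 2); lra.
  apply: le_trans Sum; rewrite sumrB -mulr_sumr sumrB SE (eq_bigr _ Sc).
  have sumS (r : R) : \sum_(q in S) r = r * (#|nbr_in c v x|%:R * #|nbr_in c v y|%:R).
    by rewrite sumr_const -[LHS]mulr_natr cS.
  rewrite !sumS ecell natrM.
  have k0 : 0 < #|K|%:R :> R by rewrite ltr0n; apply/card_gt0P; exists (c x).
  exact: (increment_bound a0 k0 (ler0n _ #|part c x|) (ler0n _ #|part c y|)
    (ler0n _ #|V|) dx dy dxy bx byy nK SEle).
pose PT := [set q | kk q \in Wt].
have T0le : (#|T0| <= C * #|PT|)%N.
  apply: leq_trans (card_triangles_over3 PT); apply: subset_leq_card.
  apply/subsetP => p pT0; have /setIdP[pT _] := pT0.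
  rewrite inE pT /= !inE /wit; case: pickP => // /(_ p).
  by rewrite pT0 /= eqxx.
have PTle : a ^+ 4 / 4 * #|PT|%:R <= \sum_q D q.
  rewrite (partition_big kk xpredT) //=.
  rewrite (bigID (mem Wt)) /= -[leLHS]addr0 lerD //; last first.
    by apply: sumr_ge0 => ij _; apply: sumr_ge0.
  rewrite -sum1_card (partition_big kk (mem Wt)) => [|q] /=; last by rewrite inE.
  rewrite natr_sum mulr_sumr; apply: ler_sum => ij ijW.
  have cellE : (\sum_(q in PT | kk q == ij) 1 <= #|cell ij|)%N.
    rewrite sum1_card; apply: subset_leq_card; apply/subsetP => q.
    by case/andP; rewrite !inE.
  have a4 : 0 <= a ^+ 4 / 4 by rewrite divr_ge0 // exprn_ge0 // ltW.
  apply: (@le_trans _ _ (a ^+ 4 / 4 * #|cell ij|%:R)).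
    by rewrite ler_wpM2l // ler_nat.
  apply: le_trans (step _ ijW) _.
  rewrite big_mkcond [leRHS]big_mkcond /=; apply: ler_sum => q _.
  case: ifP => [qS|_]; last by case: ifP.
  suff -> : kk q == ij by [].
  move: ijW qS; rewrite inE; case wij: (wit ij) => [p|//] _.
  have [_ eij] := witP _ _ wij.
  case: q => z w /setXP[]; rewrite /A /B wij !inE -eij /kk.
  move=> /andP[/eqP -> _] /andP[/eqP -> _].
  exact: eqxx.
have : C%:R * (a ^+ 4 / 4 * #|PT|%:R) <= C%:R * \sum_q D q by rewrite ler_wpM2l.
apply: le_trans; rewrite mulrCA; apply: ler_wpM2l.
  by rewrite divr_ge0 // exprn_ge0 // ltW.
by rewrite -natrM ler_nat.
Qed.
End EnergyIncrement.

(** * Iterating the increment *)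

Section FewTriangles.
Local Open Scope ring_scope.
Variables (C q m J : nat).

Definition many_triangles (V : finType) (E : rel V) : Prop :=
  [/\ symmetric E,
      forall x y, E x y -> (#|[set z | E x z && E y z]| <= C.+1)%N
    & (#|V| ^ 2 < q * #|triangles E|)%N].

Hypothesis m_def : m = (10 * C.+1 * q)%N.
Hypothesis J_def : J = (8 * q * C.+1 * m ^ 4)%N.

(** With a = 1/m at most n^2/(2q) triangles are unclean, so at least that many are clean and one
    increment adds n^2/J to the energy. [N] and [k] do not depend on the graph: the number of parts
    stays bounded, and [N] grows to meet the size condition of the next increment. *)
Lemma iterated_increment (j : nat) : (0 < q)%N ->
  exists N k : nat, forall (V : finType) (E : rel V), (N <= #|V|)%N ->
  many_triangles E -> exists (K : finType) (c : V -> K),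
    (#|K| <= k)%N /\ j%:R * #|V|%:R ^+ 2 <= J%:R * energy rat E c.
Proof.
move=> q0; have m0 : (0 < m)%N by rewrite m_def !muln_gt0 q0.
elim: j => [|j [N [k IH]]].
  exists 0%N, 1%N => V E _ _; exists unit, (fun=> tt); split; first by rewrite card_unit.
  by rewrite mul0r mulr_ge0 // energy_ge0.
exists (maxn N (2 * C.+1 * k ^ 2 * m ^ 5)), (k * (2 ^ (k * k) * 2 ^ (k * k)))%N.
move=> V E; rewrite geq_max => /andP[NV nV] mt; have [sE cE tE] := mt.
have [K [c [Kk En]]] := IH V E NV mt.
pose a : rat := m%:R^-1.
have a0 : 0 < a by rewrite invr_gt0 ltr0n.
have am : a * m%:R = 1 by rewrite mulVf // pnatr_eq0 -lt0n.
have hn : 2 * C.+1%:R * #|K|%:R ^+ 2 <= a ^+ 5 * #|V|%:R.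
  have h : (2 * C.+1 * #|K| ^ 2 * m ^ 5 <= #|V|)%N.
    by apply: leq_trans nV; rewrite !leq_mul // leq_exp2r.
  rewrite -(ler_nat rat) !(natrX, natrM) in h.
  have := ler_wpM2l (exprn_ge0 5 (ltW a0)) h; apply: le_trans.
  have -> : a ^+ 5 * (2 * C.+1%:R * #|K|%:R ^+ 2 * m%:R ^+ 5) =
     2 * C.+1%:R * #|K|%:R ^+ 2 * (a * m%:R) ^+ 5 by ring.
  by rewrite am expr1n mulr1.
have [K' [c' [cK' inc]]] := energy_increment cE sE c a0 hn.
exists K', c'; split.
  by rewrite cK' !leq_mul // leq_pexp2l // leq_mul.
have cl := card_clean cE sE c (ltW a0).
set T0 := [set p in _ | _] in inc cl.
set t := #|T0|%:R in inc cl.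
have tE' : #|V|%:R ^+ 2 <= q%:R * #|triangles E|%:R :> rat.
  by rewrite -natrX -natrM ler_nat ltnW.
have half : #|V|%:R ^+ 2 <= 2 * q%:R * t.
  have h5 : q%:R * (5 * C.+1%:R * a * #|V|%:R ^+ 2) = #|V|%:R ^+ 2 / 2.
    have mE : m%:R = 10 * C.+1%:R * q%:R :> rat by rewrite m_def !natrM.
    have -> : q%:R * (5 * C.+1%:R * a * #|V|%:R ^+ 2) =
       a * (10 * C.+1%:R * q%:R) * #|V|%:R ^+ 2 / 2 by field.
    by rewrite -mE am mul1r.
  have := ler_wpM2l (ler0n rat q) cl; rewrite mulrDr h5; lra.
have JE : J%:R = 8 * q%:R * C.+1%:R * m%:R ^+ 4 :> rat by rewrite J_def !(natrX, natrM).
have fin : #|V|%:R ^+ 2 <= J%:R * (energy rat E c' - energy rat E c).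
  have h := ler_wpM2l (_ : 0 <= 8 * q%:R * m%:R ^+ 4) inc.
  have := h ltac:(by rewrite !mulr_ge0 // exprn_ge0 //).
  have -> : 8 * q%:R * m%:R ^+ 4 * (a ^+ 4 / 4 * t) = 2 * q%:R * t * (a * m%:R) ^+ 4.
    by field.
  rewrite am expr1n mulr1 => h'; apply: le_trans half _.
  apply: le_trans h' _; rewrite JE; lra.
rewrite -[j.+1]addn1 natrD mulrDl mul1r -(subrK (energy rat E c) (energy rat E c')).
by rewrite mulrDr addrC lerD.
Qed.

End FewTriangles.

(** The energy never exceeds n^2, so J + 1 increments of n^2/J are impossible. *)
Lemma few_triangles (C q : nat) : exists n0 : nat,
  forall (V : finType) (E : rel V), n0 <= #|V| -> symmetric E ->
  (forall x y, E x y -> #|[set z | E x z && E y z]| <= C) ->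
  q * #|triangles E| <= #|V| ^ 2.
Proof.
case: (posnP q) => [->|q0]; first by exists 0.
have [N [k H]] := iterated_increment (erefl (10 * C.+1 * q)) erefl
  (8 * q * C.+1 * (10 * C.+1 * q) ^ 4).+1 q0.
exists (maxn N 1) => V E; rewrite geq_max => /andP[NV V0] sE cE.
rewrite leqNgt; apply/negP => tE.
have [|K [c [_]]] := H V E NV.
  by split=> // x y /cE /leq_trans; apply.
have := energy_le rat E c => eV; apply/negP; rewrite -ltNge.
set J := (8 * _ * _ * _).
apply: (@le_lt_trans _ _ (J%:R * #|V|%:R ^+ 2)%R); first by rewrite ler_wpM2l.
by rewrite ltr_pM2r ?exprn_gt0 ?ltr0n // ltr_nat.
Qed.

(** * Triple systems without a Berge book *)

(** A Berge book unfolded: [e] serves the spine uv, [f w] and [g w] serve uw and vw. The pages form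
    a set, so that smaller books are given by subsets. *)
Definition book_pages (V : finType) (H : {set {set V}}) (u v : V)
    (e : {set V}) (P : {set V}) (f g : V -> {set V}) : Prop :=
  [/\ u != v, [/\ e \in H, u \in e & v \in e],
      forall w, w \in P ->
        [/\ w != u, w != v, [/\ f w \in H, u \in f w & w \in f w],
            [/\ g w \in H, v \in g w & w \in g w] & f w != e /\ g w != e],
      {in P &, injective f} /\ {in P &, injective g}
    & {in P &, forall w w', f w != g w'}].

Definition has_book (V : finType) (H : {set {set V}}) (t : nat) : Prop :=
  exists u v e P f g, @book_pages V H u v e P f g /\ #|P| = t.

(** [w] shares its [f]-value with [a w] at most and its [g]-value with [b w] at most; choosing [w]
    and discarding these two costs three candidates per page. *)
Lemma greedy_pages (V : finType) (S : eqType) (t : nat) (X : {set V})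
    (f g : V -> S) (a b : V -> V) :
  {in X &, forall w w', w != w' -> f w = f w' -> w' = a w} ->
  {in X &, forall w w', w != w' -> g w = g w' -> w' = b w} ->
  3 * t <= #|X| ->
  exists P : {set V}, [/\ P \subset X, #|P| = t,
    {in P &, injective f} & {in P &, injective g}].
Proof.
elim: t X => [|t IH] X fX gX leX.
  exists set0; split; rewrite ?sub0set ?cards0 //; by move=> w; rewrite inE.
have /card_gt0P[w wX] : 0 < #|X| by apply: leq_trans leX.
pose X' := X :\ w :\ a w :\ b w.
have X'X : X' \subset X by rewrite !(subset_trans (subsetDl _ _)).
have [|||P [PX' cP fP gP]] := IH X'.
- by move=> x y /(subsetP X'X) xX /(subsetP X'X); apply: fX.
- by move=> x y /(subsetP X'X) xX /(subsetP X'X); apply: gX.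
- have := cardsD1 (b w) (X :\ w :\ a w); have := cardsD1 (a w) (X :\ w).
  have := cardsD1 w X; rewrite wX -/X'; move: leX.
  by case: (_ \in _); case: (_ \in _) => /=; lia.
have PX x : x \in P -> [/\ x \in X, x != w, x != a w & x != b w].
  by move/(subsetP PX'); rewrite !inE => /and4P[].
exists (w |: P); split.
- by rewrite subUset sub1set wX (subset_trans PX').
- rewrite cardsU1 cP; case: (boolP (w \in P)) => // /PX[_].
  by rewrite eqxx.
- move=> x y; rewrite !inE => /orP[/eqP->|xP] /orP[/eqP->|yP] //.
  + have [yX yw ya _] := PX _ yP; move/(fX _ _ wX yX _) => e.
    by move: ya; rewrite e ?eqxx // eq_sym.
  + have [xX xw xa _] := PX _ xP => /esym /(fX _ _ wX xX _) e.
    by move: xa; rewrite e ?eqxx // eq_sym.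
  + exact: fP.
- move=> x y; rewrite !inE => /orP[/eqP->|xP] /orP[/eqP->|yP] //.
  + have [yX yw _ yb] := PX _ yP; move/(gX _ _ wX yX _) => e.
    by move: yb; rewrite e ?eqxx // eq_sym.
  + have [xX xw _ xb] := PX _ xP => /esym /(gX _ _ wX xX _) e.
    by move: xb; rewrite e ?eqxx // eq_sym.
  + exact: gP.
Qed.

(** * Leaves and the page bound *)

Section TripleSystem.
Variables (V : finType) (H : {set {set V}}).
Hypothesis H3 : forall h, h \in H -> #|h| = 3.

Definition triple u v w := [set u; v; w] \in H.
Definition adj u v := [exists w, triple u v w].
Definition nbr u : {set V} := [set v | adj u v].
Definition codeg u v := #|[set w | triple u v w]|.
Definition common u v := nbr u :&: nbr v.
(* [uvw] is the only hyperedge through [uw] and the only one through [vw], so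
   [w] cannot be a page of a book with spine [uv]. *)
Definition leaf u v : {set V} :=
  [set w | [&& triple u v w, codeg u w == 1 & codeg v w == 1]].

Definition matched (F : {set V}) x y := [exists z in F, triple x y z].

Lemma triple_swap12 u v w : triple u v w = triple v u w.
Proof. by rewrite /triple (setUC [set u]). Qed.

Lemma triple_swap23 u v w : triple u v w = triple u w v.
Proof. by rewrite /triple setUAC. Qed.

Lemma triple_rot u v w : triple u v w = triple v w u.
Proof. by rewrite triple_swap12 triple_swap23. Qed.

Lemma triple_neq12 u v w : triple u v w -> u != v.
Proof.
move/H3 => c3; apply/eqP => e; move: c3; rewrite e setUid cards2.
by case: eqP.
Qed.

Lemma triple_neq13 u v w : triple u v w -> u != w.
Proof. by rewrite triple_swap23; exact: triple_neq12. Qed.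

Lemma triple_neq23 u v w : triple u v w -> v != w.
Proof. by rewrite triple_rot; exact: triple_neq12. Qed.

Lemma adj_sym u v : adj u v = adj v u.
Proof. by apply: eq_existsb => w; rewrite triple_swap12. Qed.

Lemma adj_triple u v w : triple u v w -> adj u v.
Proof. by move=> h; apply/existsP; exists w. Qed.

Lemma adj_neq u v : adj u v -> u != v.
Proof. by case/existsP => w /triple_neq12. Qed.

Lemma codeg_sym u v : codeg u v = codeg v u.
Proof. by apply: eq_card => w; rewrite !inE triple_swap12. Qed.

Lemma codeg1_eq u w a b : codeg u w = 1 -> triple u w a -> triple u w b -> a = b.
Proof.
move=> /eqP/cards1P[x e] ha hb.
have : a \in [set x] by rewrite -e inE.
have : b \in [set x] by rewrite -e inE.
by rewrite !inE => /eqP -> /eqP ->.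
Qed.

Lemma hyperedgeP h u v : h \in H -> u \in h -> v \in h -> u != v ->
  exists w, triple u v w /\ h = [set u; v; w].
Proof.
move=> hH uh vh uv.
have : #|h :\ u :\ v| = 1.
  have := cardsD1 u h; have := cardsD1 v (h :\ u).
  by rewrite !inE uh eq_sym uv vh (H3 hH) /=; lia.
case/eqP/cards1P => w /setP e.
exists w; suff hE : h = [set u; v; w] by rewrite /triple -hE.
apply/setP => x; have := e x; rewrite !inE.
case: (eqVneq x u) => [->|]; first by rewrite uh.
by case: (eqVneq x v) => [->|] //=; rewrite vh.
Qed.

(** The excluded third vertices are those for which both hyperedges are uvw. If only uvw presents
    itself, then [w] not being a leaf yields a second hyperedge through uw or vw. *)
Lemma not_leafP u v w : adj u w -> adj v w -> u != v -> w \notin leaf u v ->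
  exists p : V * V, [/\ triple u w p.1, triple v w p.2 & ~~ ((p.1 == v) && (p.2 == u))].
Proof.
move=> /existsP[a ha] /existsP[b hb] uv.
have [/andP[/eqP av /eqP bu]|] := boolP ((a == v) && (b == u)); last first.
  by exists (a, b).
subst a b; rewrite inE triple_swap23 ha /= => /nandP[] c1.
- have : 1 < codeg u w.
    rewrite ltn_neqAle eq_sym c1 /=; apply/card_gt0P; exists v; by rewrite inE.
  case/card_gt1P => x [y []]; rewrite !inE => hx hy xy.
  case: (eqVneq x v) => xv; last by exists (x, u); rewrite /= (negPf xv).
  by subst x; exists (y, u); rewrite /= eq_sym (negPf xy).
- have : 1 < codeg v w.
    rewrite ltn_neqAle eq_sym c1 /=; apply/card_gt0P; exists u; by rewrite inE.
  case/card_gt1P => x [y []]; rewrite !inE => hx hy xy.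
  case: (eqVneq x u) => xu; last by exists (v, x); rewrite /= (negPf xu) andbF.
  by subst x; exists (v, y); rewrite /= [y == u]eq_sym (negPf xy) andbF.
Qed.

Variable t : nat.
Hypothesis noBook : ~ has_book H t.
Hypothesis t_gt0 : 0 < t.

(** Two candidates share a hyperedge at one end of the spine only if each is the third vertex of the
    hyperedge of the other, which is the situation of [greedy_pages]. A hyperedge shared by distinct
    candidates at opposite ends would contain four vertices. *)
Lemma page_bound u v : adj u v -> #|common u v :\: leaf u v| <= 3 * t.
Proof.
move=> uv; have /existsP[w0 h0] := uv; have nuv := adj_neq uv.
rewrite leqNgt; apply/negP => big.
(* Giving up the third vertex of the spine hyperedge accounts for the candidate beyond [3 * t]: a
   hyperedge through any other candidate differs from that of the spine. *)
pose X := (common u v :\: leaf u v) :\ w0.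
have cX : 3 * t <= #|X|.
  by have := cardsD1 w0 (common u v :\: leaf u v); rewrite -/X; case: (_ \in _) => /=; lia.
pose Q w (p : V * V) := [&& triple u w p.1, triple v w p.2 & ~~ ((p.1 == v) && (p.2 == u))].
pose ab w := odflt (u, u) [pick p | Q w p].
have abP w : w \in X -> [/\ triple u w (ab w).1, triple v w (ab w).2 &
    ~~ (((ab w).1 == v) && ((ab w).2 == u))].
  rewrite !inE => /andP[_ /andP[nl /andP[uw vw]]].
  rewrite /ab; case: pickP => [p /and3P[]//|no].
  have [|p [h1 h2 h3]] := not_leafP uw vw nuv; first by rewrite inE.
  by have := no p; rewrite /Q h1 h2 h3.
pose f w := [set u; w; (ab w).1]; pose g w := [set v; w; (ab w).2].
have Xneq w : w \in X -> [/\ w != u, w != v & w != w0].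
  rewrite !inE => /andP[-> /andP[_ /andP[/adj_neq uw /adj_neq vw]]].
  by rewrite ![w == _]eq_sym uw vw.
have fin w w' : w \in X -> w' \in X -> w != w' -> w' \in f w -> w' = (ab w).1.
  move=> wX w'X ww'; have [w'u _ _] := Xneq _ w'X; rewrite !inE.
  by rewrite (negPf w'u) [w' == w]eq_sym (negPf ww') => /eqP.
have gin w w' : w \in X -> w' \in X -> w != w' -> w' \in g w -> w' = (ab w).2.
  move=> wX w'X ww'; have [_ w'v _] := Xneq _ w'X; rewrite !inE.
  by rewrite (negPf w'v) [w' == w]eq_sym (negPf ww') => /eqP.
have wf w : w \in f w by rewrite !inE eqxx orbT.
have wg w : w \in g w by rewrite !inE eqxx orbT.
have [||P [PX cP fP gP]] := @greedy_pages _ _ t X f g (fun w => (ab w).1)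
  (fun w => (ab w).2) _ _ cX.
- by move=> w w' wX w'X ww' e; apply: fin => //; rewrite e.
- by move=> w w' wX w'X ww' e; apply: gin => //; rewrite e.
apply: noBook; exists u, v, [set u; v; w0], P, f, g; split => //; split => //.
- by rewrite /triple in h0; rewrite h0 !inE !eqxx !orbT.
- move=> w /(subsetP PX) wX; have [h1 h2 _] := abP _ wX.
  have [wu wv ww0] := Xneq _ wX; split => //.
  + by rewrite wf !inE eqxx /=.
  + by rewrite wg !inE eqxx /=.
  + by split; apply/eqP => /setP/(_ w); rewrite ?wf ?wg !inE (negPf wu)
      (negPf wv) (negPf ww0).
- move=> w w' /(subsetP PX) wX /(subsetP PX) w'X; apply/eqP => e.
  have [h1 h2 /nandP h3] := abP _ wX.
  have [wu wv _] := Xneq _ wX; have [w'u w'v _] := Xneq _ w'X.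
  case: (eqVneq w w') => [ww'|ww'].
    have vf : v \in f w by rewrite e !inE eqxx.
    have ug : u \in g w by rewrite ww' -e !inE eqxx.
    move: vf ug; rewrite !inE (negPf nuv) [v == u]eq_sym (negPf nuv).
    rewrite [v == w]eq_sym [u == w]eq_sym (negPf wu) (negPf wv) /= => a1 a2.
    by case: h3; rewrite eq_sym ?a1 ?a2.
  have := fin _ _ wX w'X ww'; rewrite e wg => /(_ isT) w'E.
  have : v \in f w by rewrite e !inE eqxx.
  by rewrite !inE -w'E [v == u]eq_sym (negPf nuv) [v == w]eq_sym [v == w']eq_sym
    (negPf wv) (negPf w'v).
Qed.

Lemma leaf_inj v z1 z2 w : w \in leaf v z1 -> w \in leaf v z2 -> z1 = z2.
Proof.
rewrite !inE => /and3P[h1 /eqP c _] /and3P[h2 _ _].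
by apply: (codeg1_eq c); rewrite -triple_swap23.
Qed.

(** The sets [leaf v z] are disjoint for distinct [z], as the only hyperedge through vw determines
    [z]; so large leaf sets are harmless on summation. *)
Lemma sum_leaf v (S Y : {set V}) :
  \sum_(z in S) #|leaf v z :&: Y| <= #|nbr v :&: Y|.
Proof.
have -> : \sum_(z in S) #|leaf v z :&: Y| =
    \sum_(z in S) \sum_(w in nbr v :&: Y) (w \in leaf v z).
  apply: eq_bigr => z _; rewrite -sum1_card big_mkcond [RHS]big_mkcond /=.
  apply: eq_bigr => w _; rewrite !inE; case: (w \in Y); rewrite ?andbF ?andbT //.
  case: (boolP (triple v z w)) => [h|]; last by case: ifP.
  have -> : adj v w by apply: (@adj_triple _ _ z); rewrite triple_swap23.
  by case: ((_ == _) && _).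
rewrite exchange_big -sum1_card; apply: leq_sum => w _.
case: (pickP [pred z in S | w \in leaf v z]) => [z /= /andP[zS wz]|no].
  rewrite (bigD1 z) //= wz big1 // => z' /andP[_ z'z].
  by case: (boolP (w \in leaf v z')) => // wz'; rewrite (leaf_inj wz wz') eqxx in z'z.
by rewrite big1 // => z zS; have := no z; rewrite /= zS /= => ->.
Qed.

Lemma triple_common u v w : triple u v w -> w \in common u v.
Proof.
move=> h; rewrite !inE; apply/andP; split.
  by apply: (@adj_triple _ _ v); rewrite triple_swap23.
by apply: (@adj_triple _ _ u); rewrite -triple_rot.
Qed.

Lemma codeg_le v z (Y : {set V}) :
  #|[set w in Y | triple v z w]| <= 3 * t + #|leaf v z :&: Y|.
Proof.
set A := [set w in Y | _].
case: (set_0Vmem A) => [->|[w]]; first by rewrite cards0.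
rewrite inE => /andP[_ /adj_triple/page_bound] pb.
apply: (leq_trans _ (leq_add pb (leqnn _))).
apply: leq_trans (leq_card_setU _ _); apply: subset_leq_card.
apply/subsetP => x; rewrite inE => /andP[xY h]; have := triple_common h.
by rewrite !inE xY h => ->; rewrite andbT; case: (_ && _).
Qed.

(** Such a [u] is a common neighbour of [v] and [z], but no leaf, because vu is not private. *)
Lemma codeg2_le v z :
  #|[set u | triple v u z & 1 < codeg v u]| <= 3 * t.
Proof.
set A := [set u | _ & _].
case: (set_0Vmem A) => [->|[w]]; first by rewrite cards0.
rewrite inE triple_swap23 => /andP[/adj_triple/page_bound pb _]; apply: leq_trans pb.
apply: subset_leq_card; apply/subsetP => u; rewrite !inE triple_swap23 => /andP[h c2].
by have := triple_common h; rewrite !inE => ->; rewrite (gtn_eqF c2) /= andbF.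
Qed.

Lemma sum_codeg_le v (S Y : {set V}) :
  \sum_(z in S) #|[set w in Y | triple v z w]| <= 3 * t * #|S| + #|nbr v :&: Y|.
Proof.
apply: (@leq_trans (\sum_(z in S) (3 * t + #|leaf v z :&: Y|))).
  by apply: leq_sum => z _; apply: codeg_le.
by rewrite big_split /= sum_nat_const mulnC leq_add2l sum_leaf.
Qed.

End TripleSystem.

(** * Stability *)

Lemma sum_sqr_ge (I : finType) (a : I -> nat) :
  (\sum_i a i) ^ 2 <= #|I| * \sum_i a i ^ 2.
Proof.
have eL : (\sum_i a i) ^ 2 = \sum_i \sum_j a i * a j.
  by rewrite -mulnn big_distrl; apply: eq_bigr => i _; rewrite big_distrr.
have eR : 2 * (#|I| * \sum_i a i ^ 2) = \sum_i \sum_j (a i ^ 2 + a j ^ 2).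
  under [RHS]eq_bigr do rewrite big_split sum_nat_const /=.
  by rewrite big_split sum_nat_const -big_distrr /= addnn -mul2n.
rewrite -(leq_pmul2l (_ : 0 < 2)) // eR eL big_distrr; apply: leq_sum => i _.
rewrite big_distrr; apply: leq_sum => j _ /=.
by have [] := nat_Cauchy (a i) (a j).
Qed.

Lemma sum_card_setI_sym (V : finType) (E : rel V) (X Y : {set V}) : symmetric E ->
  \sum_(x in X) #|[set y | E x y] :&: Y| = \sum_(y in Y) #|[set x | E y x] :&: X|.
Proof.
move=> sE.
have aux (S U : {set V}) : \sum_(x in S) #|[set y | E x y] :&: U| =
    \sum_(x in S) \sum_(y in U) E x y.
  apply: eq_bigr => x _; rewrite -sum1_card big_mkcond [RHS]big_mkcond /=.
  by apply: eq_bigr => y _; rewrite !inE; case: (E x y); case: (y \in U).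
rewrite !aux exchange_big; apply: eq_bigr => y _.
by apply: eq_bigr => x _; rewrite sE.
Qed.

Lemma sum_pair_card (V : finType) (X Y : {set V}) (r : rel V) :
  \sum_(x in X) \sum_(y in Y) r x y = \sum_(x in X) #|[set y in Y | r x y]|.
Proof.
apply: eq_bigr => x _; rewrite -sum1_card big_mkcond [RHS]big_mkcond /=.
by apply: eq_bigr => y _; rewrite inE; case: (y \in Y) => //=; case: (r x y).
Qed.

(** The constants are those of the boundary case x = 2n/5, y = 3n/5. *)
Lemma unbalanced_product n x y :
  x + y <= n -> 5 * x < 2 * n -> 25 * (4 * (x * y)) <= 24 * n ^ 2.
Proof.
move=> xy x25; have xn := leq_mul (leqnn x) xy; rewrite mulnDr in xn.
have [d dE] : exists d, 2 * n = 5 * x + d by exists (2 * n - 5 * x); lia.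
have e1 : (2 * n) * (3 * n) = (5 * x + d) * (3 * n) by rewrite dE.
have e2 : (2 * n) * (5 * x) = (5 * x + d) * (5 * x) by rewrite dE.
have e3 : (2 * n) * d = (5 * x + d) * d by rewrite dE.
rewrite -mulnn; lia.
Qed.

Section Stability.
Variables (V : finType) (H : {set {set V}}) (t : nat).
Hypothesis H3 : forall h, h \in H -> #|h| = 3.
Hypothesis noBook : ~ has_book H t.
Hypothesis t_gt0 : 0 < t.

Local Notation T := (triple H).
Local Notation adj := (adj H).
Local Notation nbr := (nbr H).
Local Notation codeg := (codeg H).
Local Notation leaf := (leaf H).
Local Notation common := (common H).

Definition bad_edges : {set {set V}} :=
  [set h in H | ~~ [exists p : V * V * V,
     (h == [set p.1.1; p.1.2; p.2]) && (p.2 \in leaf p.1.1 p.1.2)]].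

Definition bad_adj : rel V := fun x y => [exists z, [set x; y; z] \in bad_edges].

Lemma bad_adj_sym : symmetric bad_adj.
Proof. by move=> x y; apply: eq_existsb => z; rewrite (setUC [set x]). Qed.

(** A common bad neighbour [z] is not a leaf of xy: otherwise xyz is the only hyperedge through xz,
    hence the bad one, although its leaf makes it good. *)
Lemma bad_adj_codeg x y : bad_adj x y ->
  #|[set z | bad_adj x z && bad_adj y z]| <= 3 * t.
Proof.
have sub u v : bad_adj u v -> adj u v.
  by case/existsP => w; rewrite inE => /andP[h _]; apply/existsP; exists w.
move=> /sub xy; apply: leq_trans (page_bound H3 noBook t_gt0 xy).
apply: subset_leq_card; apply/subsetP => z; rewrite !inE => /andP[xz yz].
rewrite (sub _ _ xz) (sub _ _ yz) /= andbT; apply/negP => /and3P[h /eqP c c'].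
case/existsP: xz => a; rewrite inE => /andP[ha].
rewrite (codeg1_eq c ha (_ : T x z y)); last by rewrite -triple_swap23.
case/existsP; exists (x, y, z); rewrite /= setUAC eqxx /=.
by rewrite inE h c eqxx c'.
Qed.

Lemma card_bad_edges : #|bad_edges| <= #|triangles bad_adj|.
Proof.
pose F (p : V * V * V) := [set p.1.1; p.1.2; p.2].
apply: (@leq_trans #|F @: triangles bad_adj|); last exact: leq_imset_card.
apply: subset_leq_card; apply/subsetP => h hB.
have hH : h \in H by move: hB; rewrite inE => /andP[].
have /card_gt0P[u uh] : 0 < #|h| by rewrite H3.
have /card_gt0P[v] : 0 < #|h :\ u|.
  by have := cardsD1 u h; rewrite uh H3 //=; lia.
rewrite !inE => /andP[vu vh].
have [w [_ hE]] := hyperedgeP H3 hH uh vh ltac:(by rewrite eq_sym).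
apply/imsetP; exists (u, v, w) => //; rewrite inE /=.
apply/and3P; split; apply/existsP.
- by exists w; rewrite /= -hE.
- by exists v; rewrite /= setUAC -hE.
- by exists u; rewrite /= setUC setUA -hE.
Qed.

Definition deg_sum := \sum_u #|nbr u|.

(** A hyperedge that is not bad has two private pairs, thus four ordered ones, and these belong to
    no other hyperedge. *)
Lemma deg_sum_ge : 4 * #|H| <= deg_sum + 4 * #|bad_edges|.
Proof.
pose Pp : {set V * V} := [set p | codeg p.1 p.2 == 1].
have PpS : #|Pp| <= deg_sum.
  rewrite /deg_sum; under eq_bigr do rewrite -sum1_card.
  rewrite pair_big_dep /= -sum1_card big_mkcond [leqRHS]big_mkcond /=.
  apply: leq_sum => -[u v] _; rewrite !inE /=.
  case: eqP => // c1.
  have /card_gt0P[w] : 0 < codeg u v by rewrite c1.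
  by rewrite inE => /adj_triple ->.
pose G := H :\: bad_edges.
have GP h : h \in G -> 4 <= #|[set p in Pp | (p.1 \in h) && (p.2 \in h)]|.
  rewrite !inE => /andP[+ hH]; rewrite hH negbK /= => /existsP[[[u v] w]] /=.
  move=> /andP[/eqP hE]; rewrite inE => /and3P[tuvw c1 c2].
  have uv := triple_neq12 H3 tuvw; have uw := triple_neq13 H3 tuvw; have vw := triple_neq23 H3 tuvw.
  pose l := [:: (u, w); (w, u); (v, w); (w, v)].
  have ul : uniq l.
    rewrite /= !inE !xpair_eqE !eqxx /= ![w == _]eq_sym.
    by rewrite (negPf uv) (negPf uw) (negPf vw).
  have <- : #|[set p in l]| = 4 by rewrite cardsE (card_uniqP ul).
  apply: subset_leq_card; apply/subsetP => p.
  rewrite !inE => /or4P[] /eqP -> /=; rewrite hE !inE !eqxx ?orbT ?andbT //.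
    by rewrite codeg_sym.
  by rewrite codeg_sym.
have GS : 4 * #|G| <= #|Pp|.
  rewrite mulnC -sum_nat_const.
  apply: (@leq_trans (\sum_(h in G) \sum_(p in Pp) ((p.1 \in h) && (p.2 \in h)))).
    apply: leq_sum => h /GP /leq_trans; apply.
    rewrite -sum1_card big_mkcond [leqRHS]big_mkcond /=; apply: leq_sum => p _.
    by rewrite [p \in [set _ in _ | _]]inE; case: (p \in Pp) => //=; case: (_ && _).
  rewrite exchange_big -sum1_card; apply: leq_sum => -[u v]; rewrite inE /= => c1.
  have uv : u != v.
    have /card_gt0P[w] : 0 < codeg u v by rewrite (eqP c1).
    by rewrite inE => /(triple_neq12 H3).
  pose F := [set h in G | (u \in h) && (v \in h)].
  apply: (@leq_trans #|F|).
    rewrite -sum1_card big_mkcond [leqRHS]big_mkcond /=; apply: leq_sum => h _.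
    by rewrite [h \in F]inE; case: (h \in G) => //=; case: (_ && _).
  apply/card_le1_eqP => h1 h2; rewrite !inE.
  move=> /andP[/andP[_ hH1] /andP[u1 v1]] /andP[/andP[_ hH2] /andP[u2 v2]].
  have [w1 [t1 ->]] := hyperedgeP H3 hH1 u1 v1 uv.
  have [w2 [t2 ->]] := hyperedgeP H3 hH2 u2 v2 uv.
  by rewrite (codeg1_eq (eqP c1) t1 t2).
have : #|H| <= #|G| + #|bad_edges|.
  rewrite -(cardsID bad_edges H) addnC leq_add2l subset_leq_card //.
  exact: subsetIr.
by lia.
Qed.

Lemma adj_symmetric : symmetric adj.
Proof. by move=> x y; rewrite adj_sym. Qed.

(* Mantel: the degrees of adjacent [u] and [v] sum up to [#|nbr u :|: nbr v|] plus
   the number of common neighbours, and the leaves among the latter contribute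
   only [deg_sum] in total. *)
Lemma exists_wide_edge : 0 < deg_sum -> exists u v, adj u v /\
  2 * deg_sum <= #|V| * (#|nbr u :|: nbr v| + (3 * t).+1).
Proof.
move=> s0.
have [u0 [v0 uv0]] : exists u v, adj u v.
  move: s0; rewrite lt0n sum_nat_eq0 => /forallPn[u]; rewrite -lt0n /=.
  by case/card_gt0P => v; rewrite inE; exists u, v.
(* The widest edge bounds the joint neighbourhoods of all edges, so the estimate for the sum carries
   over to it. *)
pose wd (p : V * V) := #|nbr p.1 :|: nbr p.2|.
have := @arg_maxnP _ (u0, v0) (fun p : V * V => adj p.1 p.2) wd uv0.
case=> -[u v] /= uv mx; exists u, v; split => //.
rewrite -[#|_ :|: _|]/(wd (u, v)); move: (wd (u, v)) mx => M mx.
have sumsq : 2 * \sum_u #|nbr u| ^ 2 <= deg_sum * (M + (3 * t).+1).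
  have eS : 2 * \sum_u #|nbr u| ^ 2 = \sum_u \sum_(v in nbr u) (#|nbr u| + #|nbr v|).
    under [RHS]eq_bigr do rewrite big_split sum_nat_const /= mulnn.
    rewrite big_split /= mul2n -addnn; congr (_ + _).
    transitivity (\sum_x \sum_(y | adj x y) #|nbr y|); last first.
      by apply: eq_bigr => x _; apply: eq_bigl => y; rewrite inE.
    rewrite (exchange_big_dep xpredT) //=; apply: eq_bigr => y _.
    rewrite sum_nat_const -mulnn; congr (_ * _).
    by apply: eq_card => x; rewrite !inE adj_sym.
  rewrite eS; apply: (@leq_trans (\sum_u \sum_(v in nbr u) (M + 3 * t + #|leaf u v|))).
    apply: leq_sum => x _; apply: leq_sum => y; rewrite inE => xy.
    rewrite -cardsUI -addnA leq_add //; first exact: (mx (x, y)).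
    apply: leq_trans (leq_add (page_bound H3 noBook t_gt0 xy) (leqnn _)).
    rewrite -(cardsID (leaf x y) (common x y)) addnC leq_add2l.
    exact/subset_leq_card/subsetIr.
  apply: (@leq_trans (\sum_u (#|nbr u| * (M + 3 * t) + #|nbr u|))).
    apply: leq_sum => x _; rewrite big_split /= sum_nat_const leq_add2l.
    have := sum_leaf H x (nbr x) setT; rewrite setIT; apply: leq_trans.
    by apply: leq_sum => y _; rewrite setIT.
  by rewrite big_split -big_distrl /= -/deg_sum addnS mulnS addnC.
have := sum_sqr_ge (fun u => #|nbr u|); rewrite -/deg_sum.
move: (\sum_u _) sumsq => Q h1 h2.
have : 2 * deg_sum ^ 2 <= #|V| * (deg_sum * (M + (3 * t).+1)).
  apply: (@leq_trans (2 * (#|V| * Q))); first by rewrite leq_pmul2l.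
  by rewrite mulnCA leq_mul2l h1 orbT.
by rewrite -mulnn mulnA [X in _ <= X]mulnCA [X in _ <= X]mulnC leq_pmul2r.
Qed.

(** Neighbours of [w] in [X] are common neighbours of [u] and [w]: at most [3 * t] for each [w]
    besides leaves, and at most n leaves altogether. *)
Lemma sparse_nbr u (X : {set V}) : X \subset nbr u ->
  \sum_(w in X) #|nbr w :&: X| <= (3 * t).+1 * #|V|.
Proof.
move=> Xu; apply: (@leq_trans (\sum_(w in X) (3 * t + #|leaf u w :&: setT|))).
  apply: leq_sum => w wX; have := subsetP Xu _ wX; rewrite inE => uw.
  apply: leq_trans (leq_add (page_bound H3 noBook t_gt0 uw) (leqnn _)).
  rewrite setIT addnC -(cardsID (leaf u w) (nbr w :&: X)) leq_add //.
    exact/subset_leq_card/subsetIr.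
  by apply/subset_leq_card/setSD; rewrite setIC setSI.
rewrite big_split /= sum_nat_const -[(3 * t).+1]addn1 mulnDl mul1n [#|X| * _]mulnC leq_add //.
  by rewrite leq_mul2l max_card orbT.
by apply: leq_trans (sum_leaf H u X setT) _; exact: max_card.
Qed.

(** For a wide edge uv, the sets [nbr u] and [nbr v :\: nbr u] span few edges inside and leave out
    O(n/D) vertices, so at most 4n^2/D cross pairs are missing. Vertices missing more than n/Q of
    the other set are deleted; D = 1000 Q^2 makes their number small against n/Q. *)
Lemma near_bipartition (Q D : nat) : 0 < Q -> D = 1000 * Q ^ 2 ->
  D * #|V| ^ 2 <= 2 * D * deg_sum + 2 * #|V| ^ 2 ->
  8 * D * (3 * t).+1 <= #|V| ->
  exists A B : {set V}, [/\ [disjoint A & B],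
    Q * #|~: (A :|: B)| <= #|V|,
    forall x, x \in A -> Q * #|B :\: nbr x| <= #|V|,
    forall y, y \in B -> Q * #|A :\: nbr y| <= #|V|
  & #|V| <= 3 * #|A| /\ #|V| <= 3 * #|B|].
Proof.
move=> Q0 D_def hs hn; set n := #|V| in hs hn *.
have D1 : 1000 <= D by rewrite D_def leq_pmulr // expn_gt0 Q0.
have n0 : 0 < n by apply: leq_trans hn; rewrite !muln_gt0 /=; lia.
have s0 : 0 < deg_sum.
  rewrite lt0n; apply/eqP => e; move: hs; rewrite e muln0 add0n leq_pmul2r ?expn_gt0 ?n0 //.
  by lia.
have [u [v [_ wide]]] := exists_wide_edge s0; rewrite -/n in wide.
set c := (3 * t).+1 in hn wide; set s := deg_sum in hs wide s0.
pose B' := nbr u; pose A' := nbr v :\: nbr u; pose R := ~: (nbr u :|: nbr v).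
have dAB : [disjoint A' & B'].
  by rewrite -setI_eq0 /A' /B' setDE -setIA (setIC (~: _)) setICr setI0.
have cU : #|A'| + #|B'| = #|nbr u :|: nbr v|.
  rewrite addnC -cardsUI (_ : B' :&: A' = set0); last first.
    by apply/eqP; rewrite setI_eq0 disjoint_sym.
  rewrite cards0 addn0 (_ : B' :|: A' = nbr u :|: nbr v) //.
  by apply/setP => x; rewrite !inE; case: (adj u x); case: (adj v x).
have cR : #|nbr u :|: nbr v| + #|R| = n by rewrite cardsC.
have eA : \sum_(x in A') #|nbr x :&: A'| <= c * n.
  by apply: (sparse_nbr (u := v)); exact: subsetDl.
have eB : \sum_(x in B') #|nbr x :&: B'| <= c * n by exact: (sparse_nbr (u := u)).
pose e := \sum_(x in A') #|nbr x :&: B'|.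
have e' : \sum_(x in B') #|nbr x :&: A'| = e.
  by rewrite /e (sum_card_setI_sym _ _ adj_symmetric).
have splitN (X : {set V}) : \sum_(x in X) #|nbr x| <=
    \sum_(x in X) #|nbr x :&: A'| + \sum_(x in X) #|nbr x :&: B'| + \sum_(x in X) #|nbr x :&: R|.
  rewrite -!big_split /=; apply: leq_sum => x _.
  apply: (@leq_trans #|(nbr x :&: A' :|: nbr x :&: B') :|: nbr x :&: R|); last first.
    apply: leq_trans (leq_card_setU _ _) _; rewrite leq_add2r.
    exact: leq_card_setU.
  apply/subset_leq_card/subsetP => y; rewrite !inE.
  by move=> ->; case: (adj u y); case: (adj v y).
have sR : \sum_(x in setT) #|nbr x :&: R| <= n * #|R|.
  apply: (@leq_trans (\sum_(x in [set: V]) #|R|)).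
    by apply: leq_sum => x _; apply/subset_leq_card/subsetIr.
  by rewrite sum_nat_const cardsT.
have s_le : s <= 2 * e + 2 * (c * n) + 2 * (n * #|R|).
  have -> : s = \sum_(x in A') #|nbr x| + \sum_(x in B') #|nbr x| + \sum_(x in R) #|nbr x|.
    rewrite /s /deg_sum (bigID (mem (nbr u :|: nbr v))) /=; congr (_ + _); last first.
      by apply: eq_bigl => x; rewrite !inE.
    rewrite -bigU //=; apply: eq_bigl => x; rewrite !inE.
    by case: (adj u x); case: (adj v x).
  have hR : \sum_(x in R) #|nbr x| <= #|R| * n.
    by rewrite -sum_nat_const; apply: leq_sum => x _; exact: max_card.
  have hAB : \sum_(x in A') #|nbr x :&: R| + \sum_(x in B') #|nbr x :&: R| <= n * #|R|.
    apply: leq_trans sR; rewrite -bigU //= big_mkcond [leqRHS]big_mkcond /=.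
    by apply: leq_sum => x _; rewrite in_setT; case: ifP.
  have := splitN A'; have := splitN B'; rewrite e' -/e.
  have : #|R| * n = n * #|R| by rewrite mulnC.
  lia.
have missE (X Y : {set V}) :
    \sum_(x in X) #|Y :\: nbr x| + \sum_(x in X) #|nbr x :&: Y| = #|X| * #|Y|.
  rewrite -big_split -sum_nat_const; apply: eq_bigr => x _ /=.
  by rewrite -(cardsID (nbr x) Y) addnC setIC.
have mA := missE A' B'; have mB := missE B' A'; rewrite e' in mB; rewrite -/e in mA.
have cAB : #|A'| + #|B'| + #|R| = n by lia.
set a := #|A'| in mA mB cAB; set b := #|B'| in mA mB cAB; set r := #|R| in s_le cAB cR.
have wideD := leq_mul (leqnn D) wide.
have Dr : D * r <= 3 * n.
  rewrite -(leq_pmul2r n0); have := leq_mul hn (leqnn n).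
  by rewrite -cR -mulnn in hs wideD *; rewrite /r; move: hs wideD; lia.
have De : D * n ^ 2 <= 4 * (D * e) + 15 * n ^ 2.
  have h1 := leq_mul (leqnn D) s_le.
  have h2 := leq_mul Dr (leqnn n).
  have h3 := leq_mul hn (leqnn n).
  by move: hs h1 h2 h3; rewrite -mulnn; lia.
have ab4 : 4 * (a * b) <= n ^ 2.
  apply: (@leq_trans ((a + b) ^ 2)); last by rewrite leq_sqr; lia.
  by have [] := nat_AGM2 a b.
have Dm m : m + e = a * b -> D * m <= 4 * n ^ 2.
  move=> me; have := leq_mul (leqnn D) ab4; rewrite -me.
  by move: De; lia.
have Dab : D * n ^ 2 <= 4 * (D * (a * b)) + 15 * n ^ 2.
  apply: leq_trans De _; rewrite leq_add2r -mA !leq_mul2l.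
  by rewrite leq_addl !orbT.
have DmA := Dm _ mA.
have DmB := Dm _ (etrans mB (mulnC _ _)).
(* A side below 2n/5 would cost a fixed fraction of the cross pairs. *)
have balanced x y : x + y <= n -> D * n ^ 2 <= 4 * (D * (x * y)) + 15 * n ^ 2 ->
    2 * n <= 5 * x.
  move=> xy hD; rewrite leqNgt; apply/negP => x25.
  have h : 25 * (4 * (x * y)) <= 24 * n ^ 2 by exact: unbalanced_product.
  have h1 := leq_mul (leqnn D) h; have h2 := leq_mul D1 (leqnn (n ^ 2)).
  have n2 : 0 < n ^ 2 by rewrite expn_gt0 n0.
  by move: (n ^ 2) (x * y) hD h1 h2 n2; lia.
have a25 : 2 * n <= 5 * a by apply: (balanced a b) => //; lia.
have b25 : 2 * n <= 5 * b.
  by apply: (balanced b a); rewrite 1?mulnC //; [lia | rewrite mulnC [b * a]mulnC].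
pose A := [set x in A' | Q * #|B' :\: nbr x| <= n].
pose B := [set y in B' | Q * #|A' :\: nbr y| <= n].
(* Markov's inequality: each deleted vertex accounts for more than n/Q missing pairs. *)
have cl (X Y : {set V}) : D * (\sum_(x in X) #|Y :\: nbr x|) <= 4 * n ^ 2 ->
    D * #|X :\: [set x in X | Q * #|Y :\: nbr x| <= n]| <= 4 * Q * n.
  set Z := X :\: _ => hX.
  have : #|Z| * n <= Q * \sum_(x in X) #|Y :\: nbr x|.
    rewrite -sum_nat_const big_distrr big_mkcond [leqRHS]big_mkcond /=.
    apply: leq_sum => x _; rewrite !inE; case: (x \in X) => //=; rewrite ?andbF //.
    by rewrite andbT -ltnNge; case: ifP => // /ltnW.
  move: (\sum_(x in X) _) hX => w hX hZ.
  rewrite -(leq_pmul2r n0) -mulnA; apply: (@leq_trans (D * (Q * w))).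
    by rewrite leq_mul2l hZ orbT.
  rewrite mulnCA; apply: (@leq_trans (Q * (4 * n ^ 2))).
    by rewrite leq_mul2l hX orbT.
  by rewrite -mulnn; lia.
have dA : D * #|A' :\: A| <= 4 * Q * n by exact: cl.
have dB : D * #|B' :\: B| <= 4 * Q * n by exact: cl.
have AA' : A \subset A' by apply/subsetP => x; rewrite inE => /andP[].
have BB' : B \subset B' by apply/subsetP => x; rewrite inE => /andP[].
have cA : #|A| + #|A' :\: A| = a by rewrite /a -(cardsID A A') (setIidPr AA').
have cB : #|B| + #|B' :\: B| = b by rewrite /b -(cardsID B B') (setIidPr BB').
exists A, B; split.
- by apply: disjointWl AA' _; apply: disjointWr BB' _.
- have : #|~: (A :|: B)| <= r + #|A' :\: A| + #|B' :\: B|.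
    apply: (@leq_trans #|R :|: (A' :\: A) :|: (B' :\: B)|).
      apply/subset_leq_card/subsetP => x; rewrite !inE.
      by case: (adj u x); case: (adj v x); case: (_ <= _); case: (_ <= _).
    by apply: leq_trans (leq_card_setU _ _) _; rewrite leq_add2r leq_card_setU.
  move: #|~: _| => w hw.
  have h1 : D * w <= 11 * Q * n.
    have := leq_mul (leqnn D) hw; have := leq_mul Q0 (leqnn n); lia.
  rewrite -(leq_pmul2l (_ : 0 < D)); last by lia.
  have := leq_mul (leqnn Q) h1; have : 11 * (Q ^ 2 * n) <= D * n.
    by rewrite mulnA leq_mul2r D_def leq_mul2r orbT orbT.
  by rewrite -mulnn; lia.
- move=> x; rewrite inE => /andP[_]; apply: leq_trans; rewrite leq_mul2l.
  by rewrite subset_leq_card ?orbT // setSD.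
- move=> x; rewrite inE => /andP[_]; apply: leq_trans; rewrite leq_mul2l.
  by rewrite subset_leq_card ?orbT // setSD.
- have D250 : 250 * (4 * Q * n) <= D * n.
    rewrite D_def mulnA leq_mul2r; apply/orP; right.
    by rewrite -mulnn; have := leq_mul (leqnn Q) Q0; lia.
  have small k : D * k <= 4 * Q * n -> 250 * k <= n.
    move=> hk; rewrite -(leq_pmul2l (_ : 0 < D)); last by lia.
    by apply: leq_trans D250; rewrite mulnCA leq_mul2l hk orbT.
  by have := small _ dA; have := small _ dB; lia.
Qed.

End Stability.

(** * Matched pairs of full vertices *)

Lemma pages_has_book (V : finType) (H : {set {set V}}) u v e (P : {set V}) f g t :
  book_pages H u v e P f g -> t <= #|P| -> has_book H t.
Proof.
move=> [uv eP pgP [fI gI] fg] tP.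
pose P' := [set x in take t (enum P)].
have sub : {subset P' <= P} by move=> x; rewrite inE => /mem_take; rewrite mem_enum.
exists u, v, e, P', f, g; split; last first.
  rewrite cardsE (card_uniqP (take_uniq _ (enum_uniq _))) size_take -cardE.
  by move: tP; rewrite leq_eqVlt => /orP[/eqP->|->//]; rewrite ltnn.
split=> //.
- by move=> w /sub; apply: pgP.
- by split=> a b /sub aP /sub bP; [apply: fI | apply: gI].
- by move=> a b /sub aP /sub bP; apply: fg.
Qed.

Lemma card_remove2 (V : finType) (S : {set V}) a b : 2 < #|S| -> 0 < #|S :\ a :\ b|.
Proof.
have := cardsD1 a S; have := cardsD1 b (S :\ a).
by case: (a \in S); case: (b \in S :\ a) => /=; lia.
Qed.

Section Halves.
Variables (V : finType) (m : V -> V).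

(** A transversal of the pairs formed by [m] on [Z], used to take one page from each matched
    pair. *)
Definition half (Z : {set V}) : {set V} :=
  [set y in Z | (m y \notin Z) || (enum_rank y < enum_rank (m y))].

Lemma half_subset Z : half Z \subset Z.
Proof. by apply/subsetP => y; rewrite inE => /andP[]. Qed.

Lemma card_half (Z : {set V}) :
  {in Z, forall y, m y \in Z -> m (m y) = y /\ m y != y} -> #|Z| <= 2 * #|half Z|.
Proof.
move=> mZ; rewrite -(cardsID (half Z) Z) (setIidPr (half_subset Z)) mul2n -addnn leq_add2l.
have D y : y \in Z :\: half Z -> [/\ y \in Z, m y \in Z & enum_rank (m y) < enum_rank y].
  rewrite !inE => /andP[+ yZ]; rewrite yZ /= negb_or negbK -leqNgt => /andP[myZ r].
  split=> //; rewrite ltn_neqAle r andbT; apply/negP => /eqP/ord_inj/enum_rank_inj e.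
  by have [_] := mZ _ yZ myZ; rewrite e eqxx.
have inj : {in Z :\: half Z &, injective m}.
  move=> a b /D[aZ maZ _] /D[bZ mbZ _] e.
  by have [<- _] := mZ _ aZ maZ; have [<- _] := mZ _ bZ mbZ; rewrite e.
rewrite -(card_in_imset inj); apply/subset_leq_card/subsetP => z /imsetP[y /D[yZ myZ r] ->].
by rewrite inE myZ; have [-> _] := mZ _ yZ myZ; rewrite r orbT.
Qed.

Lemma half_excl Z y : y \in half Z -> m y \in half Z -> m (m y) = y -> False.
Proof.
rewrite !inE => /andP[yZ h1] /andP[myZ h2] mm.
move: h1 h2; rewrite mm yZ myZ /= => h1 h2.
by have := ltn_trans h1 h2; rewrite ltnn.
Qed.
End Halves.

Section FullPart.
Variables (V : finType) (H : {set {set V}}) (t : nat).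
Hypothesis H3 : forall h, h \in H -> #|h| = 3.
Hypothesis noBook : ~ has_book H t.
Hypothesis t_gt0 : 0 < t.

Local Notation T := (triple H).
Local Notation adj := (adj H).
Local Notation nbr := (nbr H).
Local Notation codeg := (codeg H).
Local Notation leaf := (leaf H).
Local Notation common := (common H).

Definition mate (F : {set V}) x := odflt x [pick z in F | adj x z].
Definition mated (F : {set V}) : {set V} := [set x in F | [exists z in F, adj x z]].
Definition doubled_pairs (FA FB : {set V}) : {set V * V} := [set p |
  [&& p.1 \in FA, p.2 \in FB, matched H FA p.1 p.2 & matched H FB p.2 p.1]].
Definition missing_pairs (FA FB : {set V}) : {set V * V} :=
  [set p | [&& p.1 \in FA, p.2 \in FB & ~~ adj p.1 p.2]].
Definition matching (F : {set V}) := forall x x1 x2,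
  x \in F -> x1 \in F -> x2 \in F -> adj x x1 -> adj x x2 -> x1 = x2.

Section Mate.
Variable F : {set V}.
Hypothesis matchF : matching F.

Lemma mateP x : x \in mated F ->
  [/\ x \in F, mate F x \in F, adj x (mate F x) & x != mate F x].
Proof.
rewrite inE => /andP[xF /exists_inP[z zF xz]]; rewrite /mate.
case: pickP => [w /andP[wF xw]|/(_ z)]; last by rewrite zF xz.
by split=> //=; apply: adj_neq H3 _ _ xw.
Qed.

Lemma mate_eq x z : x \in F -> z \in F -> adj x z -> x \in mated F /\ mate F x = z.
Proof.
move=> xF zF xz; have xM : x \in mated F.
  by rewrite inE xF; apply/exists_inP; exists z.
have [_ mF xm _] := mateP xM.
by split=> //; apply: matchF xF mF zF xm xz.
Qed.

Lemma mate_mated x : x \in mated F -> mate F x \in mated F.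
Proof.
case/mateP => xF mF xm _; rewrite inE mF; apply/exists_inP; exists x => //.
by rewrite adj_sym.
Qed.

Lemma mateK x : x \in mated F -> mate F (mate F x) = x.
Proof.
case/mateP => xF mF xm _; have [|_ ->//] := mate_eq mF xF.
by rewrite adj_sym.
Qed.

Lemma mate_half_cond (Z : {set V}) : Z \subset mated F ->
  {in Z, forall y, mate F y \in Z -> mate F (mate F y) = y /\ mate F y != y}.
Proof.
move=> /subsetP ZM y /ZM yM _; split; first exact: mateK.
by have [_ _ _] := mateP yM; rewrite eq_sym.
Qed.

Lemma sum_mate (a : V -> nat) : \sum_(x in mated F) a (mate F x) = \sum_(x in mated F) a x.
Proof.
rewrite [RHS](reindex_onto (mate F) (mate F)) /=; last by move=> x; exact: mateK.
apply: eq_bigl => x; apply/idP/andP => [xM|[h /eqP <-]]; last exact: mate_mated.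
by rewrite mate_mated // mateK.
Qed.
End Mate.

Variables (FA FB : {set V}).
Hypothesis dFAB : [disjoint FA & FB].
Hypothesis matchA : matching FA.
Hypothesis matchB : matching FB.
Hypothesis leafA : forall x x', x \in FA -> x' \in FA -> adj x x' ->
  2 < #|leaf x x' :&: FB|.
Hypothesis leafB : forall y y', y \in FB -> y' \in FB -> adj y y' ->
  2 < #|leaf y y' :&: FA|.

Local Notation mA := (mate FA).
Local Notation mB := (mate FB).
Local Notation MA := (mated FA).
Local Notation MB := (mated FB).

Lemma AB_neq x y : x \in FA -> y \in FB -> (x == y = false) * (y == x = false).
Proof.
move=> xA yB; suff xy : x != y by rewrite [y == x]eq_sym (negPf xy).
by apply: contraTneq yB => <-; rewrite (disjointFr dFAB xA).
Qed.

Lemma doubledP x y : (x, y) \in doubled_pairs FA FB ->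
  [/\ x \in MA, y \in MB, T x (mA x) y & T x y (mB y)].
Proof.
rewrite inE => /and4P[/= xA yB /exists_inP[z zA h1] /exists_inP[w wB h2]].
have xz : adj x z by apply: (@adj_triple _ _ _ _ y); rewrite triple_swap23.
have yw : adj y w by apply: (@adj_triple _ _ _ _ x); rewrite triple_swap23.
have [xM ->] := mate_eq matchA xA zA xz; have [yM ->] := mate_eq matchB yB wB yw.
by split=> //; [rewrite triple_swap23 | rewrite triple_swap12].
Qed.

Lemma doubledI x y : x \in MA -> y \in MB -> T x (mA x) y -> T x y (mB y) ->
  (x, y) \in doubled_pairs FA FB.
Proof.
move=> /mateP[xA mxA _ _] /mateP[yB myB _ _] h1 h2; rewrite inE; apply/and4P; split=> //=.
  by apply/exists_inP; exists (mA x); rewrite 1?triple_swap23.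
by apply/exists_inP; exists (mB y); rewrite 1?triple_swap12.
Qed.

Definition dbl x : {set V} := [set y | (x, y) \in doubled_pairs FA FB].

Lemma dblE x y : x \in MA -> y \in MB -> T x (mA x) y -> (y \in dbl x) = T x y (mB y).
Proof.
move=> xM yM h; rewrite [LHS]inE; apply/idP/idP => [/doubledP[]//|]; exact: doubledI.
Qed.

Lemma card_doubled : #|doubled_pairs FA FB| = \sum_(x in MA) #|dbl x|.
Proof.
transitivity (\sum_(x in MA) \sum_(y in dbl x) 1).
  rewrite pair_big_dep /= -sum1_card; apply: eq_bigl => -[x y] /=.
  rewrite [y \in dbl x]inE; case: (boolP (_ \in doubled_pairs _ _)); last by rewrite andbF.
  by case/doubledP => ->.
by apply: eq_bigr => x _; rewrite sum1_card.
Qed.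

(** A doubled [y] is a common neighbour of [x] and its mate, but not a leaf: xy also lies in the
    hyperedge through the mate of [y]. *)
Lemma dbl_le x : x \in MA -> #|dbl x| <= 3 * t.
Proof.
move=> /mateP[_ _ xm _]; apply: leq_trans (page_bound H3 noBook t_gt0 xm).
apply/subset_leq_card/subsetP => y; rewrite [y \in dbl x]inE => /doubledP[xM yM h1 h2].
rewrite in_setD (triple_common h1) andbT; apply/negP; rewrite inE => /and3P[_ /eqP c _].
have [xA mxA _ _] := mateP xM; have [yB myB _ _] := mateP yM.
have := codeg1_eq c (_ : T x y (mA x)) h2; rewrite triple_swap23 => /(_ h1) e.
by have := AB_neq mxA myB; rewrite e eqxx; case.
Qed.

(* Pages on the spine [x (mA x)]: in a block with all four hyperedges both [y] and
   [mB y] are pages, in a block with three of them only one, namely the element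
   kept by [half]; in either case there are twice as many doubled pairs as pages. *)
Lemma dbl_mate_le x : x \in MA -> #|dbl x| + #|dbl (mA x)| <= 2 * (t - 1).
Proof.
move=> xM; have [xA x'A xx' nxx'] := mateP xM; have x'M := mate_mated xM.
have x'K : mA (mA x) = x by exact: mateK.
set x' := mA x in x'A xx' nxx' x'M x'K *.
(* For [y] in [I] both [x] and [x'] form a hyperedge with [y] and its mate; in [Z] and [Z'] only one
   of them does. *)
pose I := dbl x :&: dbl x'; pose Z := dbl x :\: dbl x'; pose Z' := dbl x' :\: dbl x.
pose W := I :|: half mB Z :|: half mB Z'.
pose m := mB.
have dP y : y \in dbl x -> [/\ y \in MB, T x x' y & T x y (m y)].
  by rewrite [y \in dbl x]inE => /doubledP[].
have d'P y : y \in dbl x' -> [/\ y \in MB, T x x' y & T x' y (m y)].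
  by rewrite [y \in dbl x']inE => /doubledP[_ yM]; rewrite x'K triple_swap12.
have WP y : y \in W -> [/\ y \in MB, T x x' y & (y \in dbl x) || (y \in dbl x')].
  rewrite !in_setU => /orP[/orP[|/(subsetP (half_subset _ _))]|/(subsetP (half_subset _ _))].
  - by move=> /setIP[yx _]; have [] := dP _ yx; split=> //; rewrite yx.
  - by move=> /setDP[yx _]; have [] := dP _ yx; split=> //; rewrite yx.
  - by move=> /setDP[yx _]; have [] := d'P _ yx; split=> //; rewrite yx orbT.
have cW : #|dbl x| + #|dbl x'| <= 2 * #|W|.
  have ZM : Z \subset MB by apply/subsetP => y /setDP[/dP[]].
  have Z'M : Z' \subset MB by apply/subsetP => y /setDP[/d'P[]].
  have h1 := card_half (mate_half_cond matchB ZM).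
  have h2 := card_half (mate_half_cond matchB Z'M).
  have -> : #|W| = #|I| + #|half mB Z| + #|half mB Z'|.
    rewrite !cardsU [_ :&: half mB Z' ](_ : _ = set0); last first.
      apply/setP => y; rewrite in_set0; apply/negP => /setIP[+ /(subsetP (half_subset _ _))].
      move=> + /setDP[y1 /negP y2]; rewrite in_setU => /orP[/setIP[]//|].
      by move=> /(subsetP (half_subset _ _))/setDP[].
    rewrite [_ :&: half mB Z ](_ : _ = set0) ?cards0 ?subn0 //.
    apply/setP => y; rewrite in_set0; apply/negP => /setIP[+ /(subsetP (half_subset _ _))].
    by move=> /setIP[_ y1] /setDP[_ /negP].
  have e1 := cardsID (dbl x') (dbl x); have e2 := cardsID (dbl x) (dbl x').
  rewrite setIC in e2; move: e1 e2 h1 h2; rewrite -/I -/Z -/Z'; clear; lia.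
suff : #|W| <= t - 1 by lia.
rewrite leqNgt; apply/negP => bigW; apply: noBook.
(* [s y] tells whether the hyperedge through [y] and [m y] serves the end [x] or the end [x']. For a
   fixed end it is the same hyperedge for [y] and [m y], so these pages must use opposite ends; in
   [I] the rank decides. *)
pose s y := (y \in Z) || (y \in I) && (enum_rank y < enum_rank (m y)).
pose h1 y := [set x; x'; y]; pose h2 y := [set x; y; m y]; pose h3 y := [set x'; y; m y].
pose f y := if s y then h2 y else h1 y.
pose g y := if s y then h1 y else h3 y.
(* A leaf of the matched pair provides a spine hyperedge that no page uses. *)
have /card_gt0P[y0] : 0 < #|leaf x x' :&: FB| by apply: leq_trans (leafA xA x'A xx').
move=> /setIP[y0l y0B].
have y0W : y0 \notin W.
  move: y0l; rewrite inE => /and3P[_ /eqP c /eqP c'].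
  apply/negP => /WP[y0M h /orP[/dP[_ _ k]|/d'P[_ _ k]]]; have [_ my0 _ _] := mateP y0M.
  - have := codeg1_eq c (_ : T x y0 x') k; rewrite triple_swap23 => /(_ h) e.
    by have := AB_neq x'A my0; rewrite e eqxx; case.
  - have := codeg1_eq c' (_ : T x' y0 x) k; rewrite -triple_rot => /(_ h) e.
    by have := AB_neq xA my0; rewrite e eqxx; case.
have inB y : y \in MB -> y \in FB /\ m y \in FB by case/mateP.
have sP y : y \in W -> s y -> T x y (m y).
  by move=> yW /orP[/setDP[/dP[]]|/andP[/setIP[/dP[]]]].
have nsP y : y \in W -> ~~ s y -> T x' y (m y).
  rewrite !in_setU negb_or => /orP[/orP[/setIP[_ /d'P[]]//|]|].
    by move=> /(subsetP (half_subset _ _)) -> .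
  by move=> /(subsetP (half_subset _ _))/setDP[/d'P[]].
have x'h2 y : y \in W -> x' \in h2 y = false.
  move=> /WP[/inB[yB myB] _ _]; rewrite !inE eq_sym (negPf nxx').
  by rewrite !(AB_neq x'A).
have xh3 y : y \in W -> x \in h3 y = false.
  move=> /WP[/inB[yB myB] _ _]; rewrite !inE (negPf nxx').
  by rewrite !(AB_neq xA).
have xh1 y : x \in h1 y by rewrite !inE eqxx.
have x'h1 y : x' \in h1 y by rewrite !inE eqxx orbT.
have h1_inj y y' : y \in W -> y' \in W -> h1 y = h1 y' -> y = y'.
  move=> /WP[/inB[yB _] _ _] /WP[/inB[y'B _] _ _] /setP/(_ y).
  by rewrite !inE eqxx orbT !(AB_neq xA yB) !(AB_neq x'A yB) /= => /esym/eqP.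
have mZ y : y \in W -> m y \in W -> (y \in dbl x) = (m y \in dbl x) /\
    (y \in dbl x') = (m y \in dbl x').
  move=> /WP[yM k1 _] /WP[myM k2 _]; rewrite !dblE ?x'K //; try by rewrite triple_swap12.
  by rewrite /m mateK // ![T _ (mB y) y]triple_swap23.
have mm y : y \in W -> m (m y) = y by case/WP => yM _ _; exact: mateK.
have memZ y : y \in W -> y \in Z -> y \in half mB Z.
  move=> + yZ; have /setDP[_ /negPf yn] := yZ; rewrite !in_setU in_setI yn andbF /=.
  case/orP => // /(subsetP (half_subset _ _))/setDP[y1 _]; by rewrite y1 in yn.
have memZ' y : y \in W -> y \in Z' -> y \in half mB Z'.
  move=> + yZ; have /setDP[_ /negPf yn] := yZ; rewrite !in_setU in_setI yn /=.
  case/orP => // /(subsetP (half_subset _ _))/setDP[y1 _]; by rewrite y1 in yn.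
have sm y : y \in W -> m y \in W -> s y != s (m y).
  move=> yW myW; have [e1 e2] := mZ _ yW myW; have k := mm y yW.
  have yx := (WP _ yW); case: yx => yM _ yx.
  have r : enum_rank y != enum_rank (m y) :> nat.
    have [_ _ _ ny] := mateP yM.
    by apply: contra ny => /eqP/ord_inj/enum_rank_inj e; apply/eqP.
  rewrite /s !in_setD !in_setI -e1 -e2 k.
  case y1: (y \in dbl x); case y2: (y \in dbl x') => //=.
  - by move: r; case: ltngtP.
  - have yZ : y \in Z by rewrite in_setD y1 y2.
    have myZ : m y \in Z by rewrite in_setD -e1 -e2 y1 y2.
    by case: (half_excl (memZ _ yW yZ) (memZ _ myW myZ) k).
  - have yZ : y \in Z' by rewrite in_setD y1 y2.
    have myZ : m y \in Z' by rewrite in_setD -e1 -e2 y1 y2.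
    by case: (half_excl (memZ' _ yW yZ) (memZ' _ myW myZ) k).
  - by move: yx; rewrite y1 y2.
have h2_inj y y' : y \in W -> y' \in W -> s y = s y' -> y' \in [set y; m y] -> y = y'.
  move=> yW y'W e; rewrite !inE => /orP[/eqP->//|/eqP e'].
  by have := sm y yW; rewrite -e' y'W e eqxx => /(_ isT).
apply: (@pages_has_book _ _ x x' (h1 y0) W f g); last by lia.
have h1H y : T x x' y -> h1 y \in H by [].
split=> //.
- split; rewrite ?xh1 ?x'h1 //.
  by apply: h1H; move: y0l; rewrite inE => /and3P[].
- move=> y yW; have [yM k _] := WP y yW; have [yB myB] := inB y yM.
  rewrite (AB_neq xA yB) (AB_neq x'A yB) /f /g; case: (boolP (s y)) => sy; split=> //.
  + by split; [exact: sP | rewrite !inE eqxx | rewrite !inE eqxx orbT].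
  + by split=> //; rewrite !inE eqxx orbT.
  + split; apply/eqP => e; first by have := x'h1 y0; rewrite -e x'h2.
    move/setP/(_ y0): e; rewrite !inE eqxx orbT !(AB_neq xA y0B) !(AB_neq x'A y0B) /=.
    by move/eqP => e; rewrite e yW in y0W.
  + by split=> //; rewrite !inE eqxx orbT.
  + by split; [exact: nsP | rewrite !inE eqxx | rewrite !inE eqxx orbT].
  + split; apply/eqP => e; last by have := xh1 y0; rewrite -e xh3.
    move/setP/(_ y0): e; rewrite !inE eqxx orbT !(AB_neq xA y0B) !(AB_neq x'A y0B) /=.
    by move/eqP => e; rewrite e yW in y0W.
- split=> y y' yW y'W; rewrite /f /g.
  + case sy: (s y); case sy': (s y') => e; last exact: h1_inj e.
    * apply: h2_inj => //; first by rewrite sy sy'.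
      move/setP/(_ y'): e; rewrite !inE eqxx orbT.
      have [/inB[y'B _] _ _] := WP _ y'W.
      by rewrite (AB_neq xA y'B) /= => ->.
    * by have := x'h1 y'; rewrite -e x'h2.
    * by have := x'h1 y; rewrite e x'h2.
  + case sy: (s y); case sy': (s y') => e; first exact: h1_inj e.
    * by have := xh1 y; rewrite e xh3.
    * by have := xh1 y'; rewrite -e xh3.
    * apply: h2_inj => //; first by rewrite sy sy'.
      move/setP/(_ y'): e; rewrite !inE eqxx orbT.
      have [/inB[y'B _] _ _] := WP _ y'W.
      by rewrite (AB_neq x'A y'B) /= => ->.
- move=> y y' yW y'W; rewrite /f /g; apply/eqP.
  case sy: (s y); case sy': (s y') => e.
  + by have := x'h1 y'; rewrite -e x'h2.
  + have : x \in h2 y by rewrite !inE eqxx.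
    by rewrite e xh3.
  + by have := h1_inj _ _ yW y'W e => e'; rewrite e' sy' in sy.
  + by have := xh1 y; rewrite e xh3.
Qed.

(** Summing [dbl_mate_le] over [MA] counts every doubled pair twice. *)
Lemma few_mated_doubled : #|MA| <= 2 * (t - 1) ->
  #|doubled_pairs FA FB| <= 2 * (t - 1) ^ 2.
Proof.
move=> cM; rewrite card_doubled -(leq_pmul2l (_ : 0 < 2)) //.
apply: (@leq_trans (\sum_(x in MA) 2 * (t - 1))).
  rewrite mul2n -addnn -{2}(sum_mate matchA (fun x => #|dbl x|)) -big_split.
  by apply: leq_sum => x xM; exact: dbl_mate_le.
rewrite sum_nat_const; apply: leq_trans (leq_mul cM (leqnn _)) _.
by move: (t - 1) => k; rewrite -mulnn; lia.
Qed.

(** Otherwise [y] and [mB y] are the spine of a book. Only one vertex of each mated pair is a page,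
    because [x] and [mA x] have the same two hyperedges. *)
Lemma full_block_le y : y \in MB ->
  #|[set x in MA | T x (mA x) y && T x (mA x) (mB y)]| <= 2 * (t - 1).
Proof.
move=> yM; have [yB myB yy nyy] := mateP yM; set X := [set x in MA | _].
have XM : X \subset MA by apply/subsetP => x /setIdP[].
apply: leq_trans (card_half (mate_half_cond matchA XM)) _; rewrite leq_mul2l /=.
have XP x : x \in X -> [/\ x \in MA, T x (mA x) y & T x (mA x) (mB y)].
  by rewrite inE => /and3P[].
have Xm x : x \in X -> mA x \in X.
  move=> /XP[xM h1 h2]; rewrite inE mate_mated // mateK //.
  by rewrite !(triple_swap12 _ (mA x)) h1 h2.
rewrite leqNgt; apply/negP => big; apply: noBook.
have /existsP[w hw] := yy.
pose f x := [set x; mA x; y]; pose g x := [set x; mA x; mB y].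
have hX x : x \in half mA X -> x \in X by move/(subsetP (half_subset _ _)).
have inj x x' z : z \in FB -> x \in half mA X -> x' \in half mA X ->
    [set x; mA x; z] = [set x'; mA x'; z] -> x = x'.
  move=> zB xX x'X e; have [xM _ _] := XP _ (hX _ xX); have [x'M _ _] := XP _ (hX _ x'X).
  have [x'A _ _ _] := mateP x'M.
  move/setP/(_ x'): e; rewrite !inE eqxx (AB_neq x'A zB) /= orbF.
  case/orP => /eqP // e; rewrite e in x'X.
  by case: (half_excl xX x'X (mateK matchA xM)).
apply: (@pages_has_book _ _ y (mB y) [set y; mB y; w] (half mA X) f g); last by lia.
have yF x : x \in half mA X -> (mB y \in f x = false) * (y \in g x = false).
  move=> /hX/XP[/mateP[xA mxA _ _] _ _].
  by rewrite !inE !(AB_neq xA) ?(AB_neq mxA) //= [mB y == y]eq_sym (negPf nyy).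
split=> //.
- by split; rewrite // !inE eqxx ?orbT.
- move=> x xX; have [xM h1 h2] := XP _ (hX _ xX); have [xA mxA _ _] := mateP xM.
  rewrite (AB_neq xA yB) (AB_neq xA myB); split=> //.
  + by split; [exact: h1 | rewrite !inE eqxx orbT | rewrite !inE eqxx].
  + by split; [exact: h2 | rewrite !inE eqxx orbT | rewrite !inE eqxx].
  + split; apply/eqP => e.
      by have := (yF x xX).1; rewrite e !inE eqxx orbT.
    by have := (yF x xX).2; rewrite e !inE eqxx.
- by split=> x x' xX x'X; apply: inj.
- move=> x x' xX x'X; apply/eqP => e.
  by have := (yF x xX).1; rewrite e !inE eqxx orbT.
Qed.

(** By [full_block_le], for all but 2(t-1) of the [x], the pair of [x] and [mA x] lacks a hyperedge
    with [y] or [mB y]. Apart from [3 * t] vertices per [x], such a gap comes from a missing pair,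
    and this forces [3 * t * #|MA|] missing pairs, as many as [dbl_le] allows doubled ones. The 36
    comes from 18t(2(t-1) + c) <= 36 t^2 c, where c = |MA| - 2(t-1) is positive. *)
Lemma many_mated_doubled : 2 * (t - 1) < #|MA| -> 36 * t ^ 2 <= #|MB| ->
  #|doubled_pairs FA FB| <= #|missing_pairs FA FB|.
Proof.
move=> bigA bigB.
pose free x y := ~~ T x (mA x) y.
have dA : #|doubled_pairs FA FB| <= 3 * t * #|MA|.
  rewrite card_doubled mulnC -sum_nat_const; apply: leq_sum => x; exact: dbl_le.
pose miss x := #|[set y in MB | ~~ adj x y]|.
have dM : \sum_(x in MA) miss x <= #|missing_pairs FA FB|.
  rewrite -sum_pair_card pair_big_dep /= -sum1_card big_mkcond [leqRHS]big_mkcond /=.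
  apply: leq_sum => -[x y] _ /=; case: ifP => // /andP[/mateP[xA _ _ _] /mateP[yB _ _ _]].
  by rewrite inE /= xA yB /=; case: (adj x y).
have free_le x : x \in MA -> #|[set y in MB | free x y]| <= miss x + miss (mA x) + 3 * t.
  move=> /mateP[_ _ xm _].
  apply: leq_trans (leq_add (leqnn _) (page_bound H3 noBook t_gt0 xm)).
  apply: (@leq_trans #|([set y in MB | ~~ adj x y] :|: [set y in MB | ~~ adj (mA x) y])
    :|: (common x (mA x) :\: leaf x (mA x))|); last first.
    apply: leq_trans (leq_card_setU _ _) _; rewrite leq_add2r.
    exact: leq_card_setU.
  apply/subset_leq_card/subsetP => y; rewrite /free !in_setU !inE.
  by move=> /andP[-> /negPf ->]; rewrite /=; case: (adj x y); case: (adj (mA x) y).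
have sum_free : \sum_(x in MA) #|[set y in MB | free x y]| <=
    2 * #|missing_pairs FA FB| + 3 * t * #|MA|.
  apply: (@leq_trans (\sum_(x in MA) (miss x + miss (mA x) + 3 * t))).
    by apply: leq_sum => x; exact: free_le.
  rewrite 2!big_split (sum_mate matchA miss) sum_nat_const /= [#|MA| * _]mulnC leq_add2r.
  by rewrite addnn -mul2n leq_mul2l dM.
have block : #|MB| * (#|MA| - 2 * (t - 1)) <=
    2 * \sum_(x in MA) #|[set y in MB | free x y]|.
  rewrite -!sum_pair_card exchange_big [leqRHS]mul2n -[leqRHS]addnn.
  rewrite -{2}(sum_mate matchB (fun y => \sum_(x in MA) free x y)) -big_split /=.
  rewrite -sum_nat_const; apply: leq_sum => y yM.
  rewrite leq_subLR; apply: leq_trans (leq_add (full_block_le yM) (leqnn _)).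
  have cE z : \sum_(x in MA) free x z = #|[set x in MA | free x z]|.
    rewrite -sum1_card big_mkcond [RHS]big_mkcond; apply: eq_bigr => x _.
    by rewrite inE; case: (x \in MA) => //=; case: (free x z).
  rewrite !cE; set X1 := [set x in MA | _ && _]; set X2 := [set x in MA | free x y].
  apply: (@leq_trans #|X1 :|: (X2 :|: [set x in MA | free x (mB y)])|).
    apply/subset_leq_card/subsetP => x xM; rewrite !in_setU !inE /free.
    move: xM; rewrite inE => ->; case: (T _ _ y); case: (T _ _ (mB y)) => //=.
  apply: leq_trans (leq_card_setU _ _) _; rewrite leq_add2l.
  exact: leq_card_setU.
move: dA sum_free block bigA bigB.
move: #|MA| #|MB| #|doubled_pairs _ _| #|missing_pairs _ _| (\sum_(x in MA) _).
move: t_gt0; case: t => // k _ a b d q w; rewrite subn1 /= => h1 h2 h3 h4 h5.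
have [c aE] : exists c, a = 2 * k + c.+1 by exists (a - (2 * k).+1); lia.
rewrite aE addKn in h1 h2 h3 h4.
have h6 : 36 * k.+1 ^ 2 * c.+1 <= b * c.+1 by rewrite leq_mul2r h5 orbT.
have h7 : k * c.+1 >= k by rewrite leq_pmulr.
have h8 : k.+1 * (k * c.+1) >= k.+1 * k by rewrite leq_mul2l h7 orbT.
rewrite -mulnn in h6; clear -h1 h2 h3 h6 h7 h8; nia.
Qed.

Lemma card_doubled_bound : 36 * t ^ 2 <= #|MB| ->
  #|doubled_pairs FA FB| <= #|missing_pairs FA FB| + 2 * (t - 1) ^ 2.
Proof.
move=> bigB; case: (leqP #|MA| (2 * (t - 1))) => [/few_mated_doubled h|bigA].
  by apply: leq_trans h _; rewrite leq_addl.
by apply: leq_trans (many_mated_doubled bigA bigB) _; rewrite leq_addr.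
Qed.

(* Otherwise [mA x] and [mB y] are the spine of a book with pages [x] and [y]. *)
Lemma doubled_mates_missing x y : t = 2 -> (x, y) \in doubled_pairs FA FB ->
  (mA x, mB y) \in missing_pairs FA FB.
Proof.
move=> t2 /doubledP[xM yM h1 h2].
have [xA mxA xx nxx] := mateP xM; have [yB myB yy nyy] := mateP yM.
rewrite inE /= mxA myB /=; apply/negP => /existsP[r hr]; apply: noBook; rewrite t2.
(* Besides the hyperedges of the block, each end of the spine needs one through a leaf outside the
   block; having three leaves guarantees it. *)
have /card_gt0P[b'] : 0 < #|(leaf x (mA x) :&: FB) :\ y :\ mB y|.
  by apply: card_remove2; exact: leafA.
move=> /setD1P[b'my /setD1P[b'y /setIP[]]]; rewrite inE => /and3P[kb _ _] b'B.
have /card_gt0P[a'] : 0 < #|(leaf y (mB y) :&: FA) :\ x :\ mA x|.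
  by apply: card_remove2; exact: leafB.
move=> /setD1P[a'mx /setD1P[a'x /setIP[]]]; rewrite inE => /and3P[ka _ _] a'A.
set x' := mA x in h1 mxA xx nxx hr kb a'mx *; set y' := mB y in h2 myB yy nyy hr b'my ka *.
pose f w := if w == y then [set x; x'; y] else [set x; x'; b'].
pose g w := if w == y then [set y; y'; a'] else [set x; y; y'].
have xy := AB_neq xA yB; have xy' := AB_neq xA myB; have x'y := AB_neq mxA yB.
have x'y' := AB_neq mxA myB; have xb := AB_neq xA b'B; have x'b := AB_neq mxA b'B.
have ay := AB_neq a'A yB; have ay' := AB_neq a'A myB.
exists x', y', [set x'; y'; r], [set x; y], f, g; split; last by rewrite cards2 xy.
have x'f w : x' \in f w by rewrite /f; case: ifP => _; rewrite !inE eqxx orbT.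
have y'y : (y' == y) = false by rewrite eq_sym (negPf nyy).
have y'b : (y' == b') = false by rewrite eq_sym (negPf b'my).
have x'x : (x' == x) = false by rewrite eq_sym (negPf nxx).
have x'a : (x' == a') = false by rewrite eq_sym (negPf a'mx).
have y'f w : y' \in f w = false.
  by rewrite /f; case: ifP => _; rewrite !inE xy' x'y' ?y'y ?y'b.
have y'g w : y' \in g w by rewrite /g; case: ifP => _; rewrite !inE eqxx ?orbT.
have x'g w : x' \in g w = false.
  by rewrite /g; case: ifP => _; rewrite !inE x'y x'y' ?x'x ?x'a.
split.
- by rewrite x'y'.
- by split; rewrite // !inE eqxx ?orbT.
- move=> w; rewrite !inE => wxy; split.
  + by case/orP: wxy => /eqP ->; rewrite // eq_sym x'y.
  + by case/orP: wxy => /eqP ->; rewrite // xy'.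
  + split; rewrite ?x'f // /f.
      by case: ifP.
    by case/orP: wxy => /eqP ->; rewrite ?xy ?eqxx !inE eqxx ?orbT.
  + split; rewrite ?y'g // /g.
      by case: ifP.
    by case/orP: wxy => /eqP ->; rewrite ?xy ?eqxx !inE eqxx ?orbT.
  + split; apply/eqP => e; first by have := y'f w; rewrite e !inE eqxx orbT.
    by have := x'g w; rewrite e !inE eqxx.
- split=> w w'; rewrite !inE => /orP[]/eqP-> /orP[]/eqP-> //; rewrite /f /g eqxx ?xy.
  + by move/setP/(_ y); rewrite !inE eqxx xy x'y [y == b']eq_sym (negPf b'y) /= ?orbT.
  + by move/setP/(_ y); rewrite !inE eqxx xy x'y [y == b']eq_sym (negPf b'y) /= ?orbT.
  + by move/setP/(_ x); rewrite !inE eqxx xy xy' [x == a']eq_sym (negPf a'x) /= ?orbT.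
  + by move/setP/(_ x); rewrite !inE eqxx xy xy' [x == a']eq_sym (negPf a'x) /= ?orbT.
- by move=> w w' _ _; apply/eqP => e; have := x'f w; rewrite e x'g.
Qed.

(** Taking mates in both coordinates is injective, so for t = 2 each doubled pair is paid for by its
    own missing pair. *)
Lemma doubled_le_missing : t = 2 -> #|doubled_pairs FA FB| <= #|missing_pairs FA FB|.
Proof.
move=> t2; pose F (p : V * V) := (mA p.1, mB p.2).
have inj : {in doubled_pairs FA FB &, injective F}.
  move=> [x y] [x' y'] /doubledP[xM yM _ _] /doubledP[x'M y'M _ _] [e1 e2].
  by rewrite -(mateK matchA xM) e1 (mateK matchA x'M) -(mateK matchB yM) e2 (mateK matchB y'M).
rewrite -(card_in_imset inj); apply/subset_leq_card/subsetP => p /imsetP[[x y] xy ->].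
exact: doubled_mates_missing.
Qed.

End FullPart.

(** * Counting cross pairs *)

Lemma full_leaf (V : finType) (H : {set {set V}}) (t : nat) (Y : {set V}) x x' :
  (forall h, h \in H -> #|h| = 3) -> ~ has_book H t -> 0 < t -> adj H x x' ->
  #|Y| <= #|Y :\: nbr H x| + #|Y :\: nbr H x'| + 3 * t + #|leaf H x x' :&: Y|.
Proof.
move=> H3 noBook t0 xx.
apply: leq_trans (leq_add (leq_add (leqnn _) (page_bound H3 noBook t0 xx)) (leqnn _)).
apply: (@leq_trans #|(Y :\: nbr H x :|: Y :\: nbr H x') :|: (common H x x' :\: leaf H x x')
  :|: (leaf H x x' :&: Y)|); last first.
  apply: leq_trans (leq_card_setU _ _) _; rewrite leq_add2r.
  apply: leq_trans (leq_card_setU _ _) _; rewrite leq_add2r.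
  exact: leq_card_setU.
apply/subset_leq_card/subsetP => y yY.
rewrite !in_setU !in_setD !in_setI yY /= !andbT.
by case: (y \in nbr H x); case: (y \in nbr H x'); case: (y \in leaf H x x').
Qed.

Lemma card_swapped (V : finType) (S S' : {set V * V}) :
  (forall x y, ((x, y) \in S) = ((y, x) \in S')) -> #|S| = #|S'|.
Proof.
move=> SS'; have inj : injective (fun p : V * V => (p.2, p.1)) by move=> [? ?] [? ?] [-> ->].
rewrite -(card_imset (mem S') inj); apply: eq_card => -[x y]; rewrite SS'.
apply/idP/imsetP => [h|[[a b] h [-> ->]]//]; by exists (y, x).
Qed.

Section Counting.
Variables (V : finType) (H : {set {set V}}) (t : nat).
Hypothesis H3 : forall h, h \in H -> #|h| = 3.
Hypothesis noBook : ~ has_book H t.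
Hypothesis t_gt0 : 0 < t.

Local Notation T := (triple H).
Local Notation adj := (adj H).
Local Notation nbr := (nbr H).
Local Notation codeg := (codeg H).
Local Notation leaf := (leaf H).
Local Notation common := (common H).

(** Up to the terms on the right, [nbr v :&: Y] consists of leaves of v x1 and equally of leaves of
    v x2, two disjoint sets. Hence a vertex with many neighbours across has at most one well
    connected neighbour on its own side. *)
Lemma two_nbrs v x1 x2 (Y : {set V}) : adj v x1 -> adj v x2 -> x1 != x2 ->
  #|nbr v :&: Y| <= #|Y :\: nbr x1| + #|Y :\: nbr x2| + 6 * t.
Proof.
move=> a1 a2 x12.
have one x : adj v x -> #|nbr v :&: Y| <= #|Y :\: nbr x| + 3 * t + #|leaf v x :&: Y|.
  move=> vx; rewrite -addnA.
  apply: leq_trans (leq_add (leqnn _) (leq_add (page_bound H3 noBook t_gt0 vx) (leqnn _))).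
  apply: (@leq_trans #|(Y :\: nbr x) :|: ((common v x :\: leaf v x) :|: (leaf v x :&: Y))|).
    apply/subset_leq_card/subsetP => w; rewrite !inE => /andP[-> ->].
    by case: (adj x w); case: (T v x w); case: (codeg v w == 1); case: (codeg x w == 1).
  apply: leq_trans (leq_card_setU _ _) _; rewrite leq_add2l.
  exact: leq_card_setU.
have := sum_leaf H v [set x1; x2] Y.
rewrite (big_setU1 x1) ?inE //= big_set1.
have := one _ a1; have := one _ a2; lia.
Qed.

Variables (A0 B0 : {set V}) (m : nat).
Hypothesis A0B0 : [disjoint A0 & B0].
Hypothesis rest_le : #|~: (A0 :|: B0)| <= m.
Hypothesis A0_miss : forall x, x \in A0 -> #|B0 :\: nbr x| <= m.
Hypothesis B0_miss : forall y, y \in B0 -> #|A0 :\: nbr y| <= m.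
Hypothesis A0_big : #|V| <= 3 * #|A0|.
Hypothesis B0_big : #|V| <= 3 * #|B0|.
Hypothesis n_big : 2000 * (3 * t).+1 * (3 * m + 6 * t).+1 <= #|V|.

Local Notation n := #|V|.
Definition fullA : {set V} := [set v | 100 * #|B0 :\: nbr v| <= n].
Definition fullB : {set V} := [set v | 100 * #|A0 :\: nbr v| <= n].
(** The threshold is the bound of [two_nbrs] for two vertices of [A0]: above it a vertex has at most
    one neighbour in [A0], otherwise it has few in [B0]. Either way it has few neighbours on its own
    side. *)
Definition sideA : {set V} := [set v | 2 * m + 6 * t < #|nbr v :&: B0|].
Definition sideB : {set V} := ~: sideA.
Definition poor : {set V} := ~: (fullA :|: fullB).
Let s := 3 * m + 6 * t.

Lemma n_big1 : 2000 * (3 * m + 6 * t).+1 <= n.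
Proof. by apply: leq_trans n_big; rewrite leq_mul2r leq_pmulr ?orbT. Qed.

Lemma nbr_setI_ge v (Y : {set V}) : #|Y| = #|nbr v :&: Y| + #|Y :\: nbr v|.
Proof. by rewrite setIC cardsID. Qed.

Lemma nbrA0_le1 v : v \in sideA -> #|nbr v :&: A0| <= 1.
Proof.
rewrite inE ltnNge => /negP big; rewrite leqNgt; apply/negP => /card_gt1P[x1 [x2]].
rewrite !inE => -[/andP[v1 x1A] /andP[v2 x2A] x12].
apply: big; apply: leq_trans (two_nbrs B0 v1 v2 x12) _.
by have := A0_miss x1A; have := A0_miss x2A; lia.
Qed.

Lemma nbrB0_le v : v \in sideB -> #|nbr v :&: B0| <= 2 * m + 6 * t.
Proof. by rewrite !inE -leqNgt. Qed.

Lemma fullA_sideA : fullA \subset sideA.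
Proof.
apply/subsetP => v; rewrite !inE => h; have := nbr_setI_ge v B0; have := n_big1; lia.
Qed.

Lemma fullB_sideB : fullB \subset sideB.
Proof.
apply/subsetP => v; rewrite inE => h; rewrite inE; apply/negP => /nbrA0_le1.
have := nbr_setI_ge v A0; have := n_big1; lia.
Qed.

Lemma A0_fullA : A0 \subset fullA.
Proof. by apply/subsetP => x /A0_miss; rewrite inE; have := n_big1; lia. Qed.

Lemma B0_fullB : B0 \subset fullB.
Proof. by apply/subsetP => x /B0_miss; rewrite inE; have := n_big1; lia. Qed.

Lemma poor_le : #|poor| <= m.
Proof.
apply: leq_trans rest_le; apply/subset_leq_card; rewrite setCS.
by rewrite setUSS ?A0_fullA ?B0_fullB.
Qed.

Lemma sideA_cover : sideA \subset A0 :|: ~: (A0 :|: B0).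
Proof.
apply/subsetP => v vA; rewrite !inE; case: (boolP (v \in A0)) => //= _.
apply/negP => /(subsetP B0_fullB)/(subsetP fullB_sideB).
by rewrite inE vA.
Qed.

Lemma sideB_cover : sideB \subset B0 :|: ~: (A0 :|: B0).
Proof.
apply/subsetP => v vB; rewrite in_setU in_setC in_setU.
case: (boolP (v \in B0)) => //= _; rewrite orbF; apply/negP => /(subsetP A0_fullA)/(subsetP fullA_sideA).
by move: vB; rewrite !inE => /negPf ->.
Qed.

Lemma nbr_cover v (X Y : {set V}) : X \subset Y :|: ~: (A0 :|: B0) ->
  #|nbr v :&: X| <= #|nbr v :&: Y| + m.
Proof.
move=> XY; apply: leq_trans (leq_add (leqnn _) rest_le).
apply: leq_trans (leq_card_setU _ _); apply/subset_leq_card/subsetP => x.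
rewrite inE => /andP[vx /(subsetP XY)]; rewrite !inE in vx *.
by rewrite vx.
Qed.

Lemma nbr_sideA v : v \in sideA -> #|nbr v :&: sideA| <= s.+1.
Proof.
by move=> /nbrA0_le1; have := nbr_cover v sideA_cover; rewrite /s; lia.
Qed.

Lemma nbr_sideB v : v \in sideB -> #|nbr v :&: sideB| <= s.+1.
Proof.
by move=> /nbrB0_le; have := nbr_cover v sideB_cover; rewrite /s; lia.
Qed.

Lemma fullA_matching x x1 x2 : x \in fullA -> x1 \in fullA -> x2 \in fullA ->
  adj x x1 -> adj x x2 -> x1 = x2.
Proof.
rewrite !inE => h h1 h2 a1 a2; case: (eqVneq x1 x2) => // x12.
have := two_nbrs B0 a1 a2 x12; have := nbr_setI_ge x B0; have := n_big1; lia.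
Qed.

Lemma fullB_matching x x1 x2 : x \in fullB -> x1 \in fullB -> x2 \in fullB ->
  adj x x1 -> adj x x2 -> x1 = x2.
Proof.
rewrite !inE => h h1 h2 a1 a2; case: (eqVneq x1 x2) => // x12.
have := two_nbrs A0 a1 a2 x12; have := nbr_setI_ge x A0; have := n_big1; lia.
Qed.

Lemma side_full v : v \notin poor -> (v \in sideA -> v \in fullA) /\ (v \in sideB -> v \in fullB).
Proof.
rewrite in_setC negbK inE => /orP[vA|vB]; split => //.
- by rewrite inE (subsetP fullA_sideA _ vA).
- by move: (subsetP fullB_sideB _ vB); rewrite inE => /negPf ->.
Qed.

Definition mono : {set {set V}} :=
  [set h in H | (h \subset sideA) || (h \subset sideB)].

Definition side v := if v \in sideA then sideA else sideB.

Lemma nbr_side v : #|nbr v :&: side v| <= s.+1.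
Proof.
rewrite /side; case: ifP => [|vA]; first exact: nbr_sideA.
by apply: nbr_sideB; rewrite inE vA.
Qed.

(** Three full vertices on one side form no hyperedge, since two of them would be neighbours of the
    third in a matching. So there is a poor vertex, which has at most [s.+1] neighbours on its
    side. *)
Lemma card_mono : #|mono| <= #|poor| * ((3 * t).+1 * s.+1).
Proof.
pose tr : {set V * V * V} := [set p | [&& p.1.1 \in poor, p.1.2 \in side p.1.1,
  p.2 \in side p.1.1 & T p.1.1 p.1.2 p.2]].
have cov : mono \subset [set [set p.1.1; p.1.2; p.2] | p in tr].
  apply/subsetP => h; rewrite inE => /andP[hH hs].
  have [v vh vp] : exists2 v, v \in h & v \in poor.
    apply/exists_inP; rewrite -[X in is_true X]negbK negb_exists_in; apply/negP.
    move=> /forall_inP allfull.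
    have /card_gt0P[x1 x1h] : 0 < #|h| by rewrite H3.
    have /card_gt0P[x2] : 0 < #|h :\ x1|.
      by have := cardsD1 x1 h; rewrite x1h H3 //=; lia.
    rewrite !inE => /andP[x21 x2h].
    have [x3 [t3 hE]] := hyperedgeP H3 hH x1h x2h ltac:(by rewrite eq_sym).
    have x3h : x3 \in h by rewrite hE !inE eqxx orbT.
    have [a1 a2] : adj x1 x2 /\ adj x1 x3.
      by split; [apply: adj_triple t3 | apply: (@adj_triple _ _ _ _ x2); rewrite triple_swap23].
    have := triple_neq23 H3 t3; case/orP: hs => /subsetP hs.
    - have f x : x \in h -> x \in fullA.
        by move=> xh; have [fA _] := side_full (allfull x xh); apply: fA; apply: hs.
      by rewrite (fullA_matching (f _ x1h) (f _ x2h) (f _ x3h) a1 a2) eqxx.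
    - have f x : x \in h -> x \in fullB.
        by move=> xh; have [_ fB] := side_full (allfull x xh); apply: fB; apply: hs.
      by rewrite (fullB_matching (f _ x1h) (f _ x2h) (f _ x3h) a1 a2) eqxx.
  have /card_gt0P[z] : 0 < #|h :\ v|.
    by have := cardsD1 v h; rewrite vh H3 //=; lia.
  rewrite !inE => /andP[zv zh].
  have [w [tw hE]] := hyperedgeP H3 hH vh zh ltac:(by rewrite eq_sym).
  have wh : w \in h by rewrite hE !inE eqxx orbT.
  have hside : {subset h <= side v}.
    rewrite /side; case/orP: hs => /subsetP hs; first by rewrite hs.
    by have := hs v vh; rewrite inE => /negPf ->.
  apply/imsetP; exists (v, z, w) => //.
  by rewrite inE /= vp !hside.
apply: leq_trans (subset_leq_card cov) _; apply: leq_trans (leq_imset_card _ _) _.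
have -> : #|tr| = \sum_(v in poor) \sum_(z in nbr v :&: side v) #|[set w in side v | T v z w]|.
  transitivity (\sum_(v in poor) \sum_(z in nbr v :&: side v) \sum_(w in side v | T v z w) 1).
    rewrite pair_big_dep pair_big_dep /= -sum1_card; apply: eq_bigl => -[[v z] w].
    rewrite !inE /=; case: (boolP (T v z w)) => [tw|]; last by rewrite !andbF.
    by rewrite (adj_triple tw) !andbT andbA.
  apply: eq_bigr => v _; apply: eq_bigr => z _; rewrite -sum1_card.
  by apply: eq_bigl => w; rewrite !inE.
rewrite -sum_nat_const; apply: leq_sum => v vp.
apply: leq_trans (sum_codeg_le H3 noBook t_gt0 _ _ _) _.
rewrite -[(3 * t).+1]addn1 mulnDl mul1n leq_add ?nbr_side //.
by rewrite leq_mul2l nbr_side orbT.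
Qed.

Local Notation matched := (matched H).
Local Notation doubled := (doubled_pairs H fullA fullB).

(* Only the hyperedge through [x], [y] and a full partner of the full vertex [x]
   is not counted. *)
Definition excess (sd : {set V}) x y :=
  #|[set z in sd | T x y z && ((x \in poor) || (z \in poor))]|.

(** If neither [x] nor [z] is poor, both are full on the same side and [z] is the unique mate of
    [x]. *)
Lemma side_split (sd F : {set V}) x y :
  (forall v, v \in sd -> v \notin poor -> v \in F) ->
  (forall v v1 v2, v \in F -> v1 \in F -> v2 \in F -> adj v v1 -> adj v v2 -> v1 = v2) ->
  x \in sd ->
  #|[set z in sd | T x y z]| <= excess sd x y + ((x \in F) && matched F x y).
Proof.
move=> sdF Fmatch xsd; set S := [set z in sd | _].
pose X := [set z in sd | T x y z && ((x \in poor) || (z \in poor))].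
apply: (@leq_trans (#|X| + #|S :\: X|)).
  by rewrite -(cardsID X S) leq_add2r subset_leq_card // subsetIr.
rewrite leq_add2l.
have SX z : z \in S :\: X -> [/\ x \in F, z \in F, T x y z & adj x z].
  rewrite in_setD [z \in X]inE [z \in S]inE => /andP[+ /andP[zsd h]].
  rewrite zsd h /= negb_or => /andP[xp zp].
  split=> //; [exact: sdF xp|exact: sdF zp|].
  by apply: (@adj_triple _ _ _ _ y); rewrite triple_swap23.
case: (set_0Vmem (S :\: X)) => [->|[z /SX[xF zF h _]]]; first by rewrite cards0.
have -> : matched F x y by apply/exists_inP; exists z.
rewrite xF; apply/card_le1_eqP => z1 z2 /SX[_ z1F _ a1] /SX[_ z2F _ a2].
exact: Fmatch xF z2F z1F a2 a1.
Qed.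

(** Apart from the excess, each side contributes at most a mate as third vertex, and contributions
    from both sides make the pair doubled. A single hyperedge is covered by the 1, so the excess is
    charged only for codegree above 1, as [sum_excess] needs. *)
Lemma codeg_split x y : x \in sideA -> y \in sideB ->
  codeg x y + ~~ adj x y <=
    1 + (1 < codeg x y) * (excess sideA x y + excess sideB y x) + ((x, y) \in doubled).
Proof.
move=> xA yB.
have c0 : ~~ adj x y -> codeg x y = 0.
  by move=> na; apply: eq_card0 => z; rewrite inE; apply: contraNF na => /adj_triple.
case: (boolP (adj x y)) => [_|/c0 ->] //=.
case: (ltnP 1 (codeg x y)) => [c2|c1]; last by rewrite mul0n; lia.
have cE : codeg x y = #|[set z in sideA | T x y z]| + #|[set z in sideB | T y x z]|.
  rewrite /codeg -(cardsID sideA [set z | T x y z]); congr (_ + _); apply: eq_card => z;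
    by rewrite !inE 1?triple_swap12 // andbC.
have hA := side_split y (fun v vA vp => (side_full vp).1 vA) fullA_matching xA.
have hB := side_split x (fun v vB vp => (side_full vp).2 vB) fullB_matching yB.
rewrite inE /= mul1n cE; move: hA hB.
by case: (x \in fullA); case: (y \in fullB); case: (matched fullA x y);
  case: (matched fullB y x) => /=; lia.
Qed.

(* For fixed [x] and [z] only [3t] vertices [y] give a hyperedge [xyz] with [xy]
   in a second hyperedge, so the excess is governed by the few edges inside a
   side that meet a poor vertex. *)
Lemma sum_excess (sd : {set V}) :
  (forall v, v \in sd -> #|nbr v :&: sd| <= s.+1) ->
  \sum_(x in sd) \sum_(y in ~: sd) (1 < codeg x y) * excess sd x y
    <= 2 * #|poor| * (s.+1 * (3 * t)).
Proof.
move=> nb.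
pose far x z := (x \in poor) || (z \in poor).
have e1 x : \sum_(y in ~: sd) (1 < codeg x y) * excess sd x y <=
    \sum_(z in nbr x :&: sd | far x z) 3 * t.
  apply: (@leq_trans (\sum_(y in ~: sd) \sum_(z in nbr x :&: sd | far x z)
     (T x y z && (1 < codeg x y)))).
    apply: leq_sum => y _; case: (1 < codeg x y); rewrite ?mul0n // mul1n.
    rewrite /excess -sum1_card big_mkcond [leqRHS]big_mkcond /=.
    apply: leq_sum => z _; rewrite [z \in [set _ in sd | _]]inE in_setI [z \in nbr x]inE.
    case: (boolP (T x y z)) => h; rewrite ?andbF //.
    have -> : adj x z by apply: (@adj_triple _ _ _ _ y); rewrite triple_swap23.
    by rewrite -/(far x z) andbT; case: (z \in sd) => //=; case: (far x z).
  rewrite exchange_big; apply: leq_sum => z _.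
  apply: leq_trans (codeg2_le H3 noBook t_gt0 x z).
  rewrite -sum1_card big_mkcond [leqRHS]big_mkcond; apply: leq_sum => y _.
  by rewrite !inE; case: (y \in sd) => //=; case: (T x y z && _).
apply: (@leq_trans (\sum_(x in sd) \sum_(z in nbr x :&: sd | far x z) 3 * t)).
  by apply: leq_sum => x _.
under eq_bigr do rewrite sum_nat_const; rewrite -big_distrl /=.
rewrite [2 * _ * _](mulnA (2 * #|poor|)) leq_mul2r; apply/orP; right.
pose P x := [set z in nbr x :&: sd | x \in poor].
pose P' x := [set z in nbr x :&: sd | z \in poor].
apply: (@leq_trans (\sum_(x in sd) (#|P x| + #|P' x|))).
  apply: leq_sum => x _; apply: leq_trans (leq_card_setU _ _).
  apply/subset_leq_card/subsetP => z /andP[zN /orP[] zp].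
    by rewrite in_setU [z \in P x]inE zN zp.
  by rewrite in_setU [z \in P' x]inE zN zp orbT.
rewrite big_split mul2n -addnn mulnDl; apply: leq_add.
- rewrite -sum_nat_const big_mkcond [leqRHS]big_mkcond /=; apply: leq_sum => x _.
  case: (boolP (x \in sd)) => [xsd|//].
  case: (boolP (x \in poor)) => [xp|xp].
    by apply: leq_trans (nb x xsd); apply/subset_leq_card/subsetP => z /setIdP[].
  by rewrite leqn0 cards_eq0; apply/eqP/setP => z; rewrite inE (negPf xp) andbF in_set0.
have -> : \sum_(x in sd) #|P' x| = \sum_(z in poor :&: sd) #|nbr z :&: sd|.
  transitivity (\sum_(x in sd) #|[set z | adj x z] :&: (poor :&: sd)|).
    apply: eq_bigr => x _; apply: eq_card => z.
    rewrite [z \in P' x]inE !in_setI.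
    by case: (z \in nbr x); case: (z \in sd); rewrite ?andbF ?andbT.
  by rewrite sum_card_setI_sym // => a b; rewrite adj_sym.
apply: (@leq_trans (\sum_(z in poor :&: sd) s.+1)).
  by apply: leq_sum => z /setIP[_ /nb].
by rewrite sum_nat_const leq_mul2r subset_leq_card ?orbT // subsetIl.
Qed.

Lemma card_edges_through x y : x != y ->
  #|[set h in H | (x \in h) && (y \in h)]| <= codeg x y.
Proof.
move=> xy; apply: leq_trans (leq_imset_card (fun w => [set x; y; w]) _).
apply/subset_leq_card/subsetP => h; rewrite inE => /andP[hH /andP[xh yh]].
have [w [tw ->]] := hyperedgeP H3 hH xh yh xy.
by apply/imsetP; exists w; rewrite ?inE.
Qed.

(** A hyperedge meeting both sides splits as 1 + 2. *)
Lemma two_cross_pairs :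
  2 * #|H| <= \sum_(x in sideA) \sum_(y in sideB) codeg x y + 2 * #|mono|.
Proof.
have -> : #|H| = #|H :\: mono| + #|mono|.
  rewrite -(cardsID mono H) addnC (setIidPr _) //.
  by apply/subsetP => h; rewrite inE => /andP[].
rewrite mulnDr leq_add2r.
apply: (@leq_trans (\sum_(h in H :\: mono) \sum_(x in sideA) \sum_(y in sideB)
   ((x \in h) && (y \in h)))).
  rewrite mulnC -sum_nat_const; apply: leq_sum => h.
  rewrite in_setD inE negb_and negb_or => /andP[+ hH]; rewrite hH /= => /andP[nA nB].
  have -> : \sum_(x in sideA) \sum_(y in sideB) ((x \in h) && (y \in h))
      = #|h :&: sideA| * #|h :&: sideB|.
    rewrite -sum_nat_const big_mkcond [RHS]big_mkcond /=; apply: eq_bigr => x _.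
    rewrite in_setI; case: (x \in sideA); rewrite ?andbF ?andbT //.
    case: (x \in h) => /=; last by rewrite big1.
    rewrite -sum1_card big_mkcond [RHS]big_mkcond /=; apply: eq_bigr => y _.
    by rewrite in_setI andbC; case: (_ \in sideB).
  have hA : 0 < #|h :&: sideA|.
    rewrite lt0n cards_eq0; apply: contra nB => /eqP h0.
    by rewrite -[sideB]setCK setCK -disjoints_subset -setI_eq0 h0.
  have hB : 0 < #|h :&: sideB|.
    rewrite lt0n cards_eq0; apply: contra nA => /eqP h0.
    by rewrite -[sideA]setCK -disjoints_subset -setI_eq0 h0.
  have : #|h :&: sideA| + #|h :&: sideB| = 3 by rewrite -(H3 hH) -setDE cardsID.
  by move: hA hB; case: #|h :&: sideA| => [//|[|[|a]]]; case: #|h :&: sideB| => [|[|[|b]]].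
rewrite exchange_big; apply: leq_sum => x xA; rewrite exchange_big.
apply: leq_sum => y yB; have xy : x != y.
  by apply: contraTneq yB => <-; rewrite inE xA.
apply: leq_trans (card_edges_through xy); rewrite -sum1_card.
rewrite big_mkcond [leqRHS]big_mkcond /=; apply: leq_sum => h _.
rewrite in_setD [X in _ <= (if X then _ else _)]inE.
case: (h \in H); rewrite ?andbF //= andbT.
by case: (h \in mono) => //=; case: ((x \in h) && _).
Qed.

Local Notation missing := (missing_pairs H fullA fullB).

(** A poor vertex misses more than n/100 of the opposite core. As the cores are full, these pairs
    are neither in [missing] nor counted from both ends. *)
Lemma sum_missing :
  100 * #|missing| + #|poor| * n <=
    100 * \sum_(x in sideA) \sum_(y in sideB) ~~ adj x y.
Proof.
have missE : #|missing| = \sum_(x in sideA) \sum_(y in sideB)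
    [&& x \in fullA, y \in fullB & ~~ adj x y].
  transitivity (\sum_x \sum_y if (x, y) \in missing then 1 else 0).
    by rewrite pair_bigA -sum1_card big_mkcond; apply: eq_bigr => -[x y].
  rewrite [RHS]big_mkcond.
  apply: eq_bigr => x _; case: ifP => xA; last first.
    rewrite big1 // => y _; rewrite inE /=; case: ifP => // /and3P[xf _ _].
    by rewrite (subsetP fullA_sideA _ xf) in xA.
  rewrite [RHS]big_mkcond; apply: eq_bigr => y _; rewrite inE /=.
  case: (boolP (y \in sideB)) => yB; first by case: [&& _, _ & _].
  case: ifP => // /and3P[_ yf _]; by rewrite (subsetP fullB_sideB _ yf) in yB.
have A_le : #|poor :&: sideA| * n <= 100 * \sum_(x in sideA) \sum_(y in sideB)
    [&& x \in poor, y \in B0 & ~~ adj x y].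
  rewrite -sum_nat_const big_distrr big_mkcond [leqRHS]big_mkcond /=.
  apply: leq_sum => x _; rewrite in_setI; case: (x \in sideA); rewrite ?andbF // andbT.
  case: (boolP (x \in poor)) => // xp.
  have : x \notin fullA by move: xp; rewrite !inE negb_or => /andP[].
  rewrite inE -ltnNge => /ltnW /leq_trans; apply; rewrite leq_mul2l /=.
  rewrite -sum1_card big_mkcond [leqRHS]big_mkcond /=; apply: leq_sum => y _.
  rewrite !inE; case: (boolP (y \in B0)) => yB0; rewrite ?andbF //.
  have : y \in sideB by rewrite (subsetP fullB_sideB) // (subsetP B0_fullB).
  by rewrite !inE => ->; case: (adj x y).
have B_le : #|poor :&: sideB| * n <= 100 * \sum_(x in sideA) \sum_(y in sideB)
    [&& y \in poor, x \in A0 & ~~ adj x y].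
  rewrite exchange_big -sum_nat_const big_distrr big_mkcond [leqRHS]big_mkcond /=.
  apply: leq_sum => y _; rewrite in_setI; case: (y \in sideB); rewrite ?andbF // andbT.
  case: (boolP (y \in poor)) => // yp.
  have : y \notin fullB by move: yp; rewrite !inE negb_or => /andP[].
  rewrite inE -ltnNge => /ltnW /leq_trans; apply; rewrite leq_mul2l /=.
  rewrite -sum1_card big_mkcond [leqRHS]big_mkcond /=; apply: leq_sum => x _.
  rewrite !inE adj_sym; case: (boolP (x \in A0)) => xA0; rewrite ?andbF //.
  have : x \in sideA by rewrite (subsetP fullA_sideA) // (subsetP A0_fullA).
  by rewrite inE => ->; case: (adj x y).
have cp : #|poor| = #|poor :&: sideA| + #|poor :&: sideB| by rewrite -setDE cardsID.
rewrite cp mulnDl missE.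
apply: leq_trans (leq_add (leqnn _) (leq_add A_le B_le)) _.
rewrite -!mulnDr leq_mul2l /= -!big_split; apply: leq_sum => x xA.
rewrite -!big_split; apply: leq_sum => y yB /=.
have pA : x \in poor -> (x \in fullA = false) /\ (x \in A0 = false).
  rewrite in_setC in_setU negb_or => /andP[/negPf f _]; split => //.
  by apply/negP => /(subsetP A0_fullA); rewrite f.
have pB : y \in poor -> (y \in fullB = false) /\ (y \in B0 = false).
  rewrite in_setC in_setU negb_or => /andP[_ /negPf f]; split => //.
  by apply/negP => /(subsetP B0_fullB); rewrite f.
case: (adj x y); rewrite ?andbF //= !andbT.
case: (boolP (x \in poor)) => [/pA[-> ->]|_]; case: (boolP (y \in poor)) => [/pB[-> ->]|_];
  rewrite ?andbF //=; by do !case: (_ \in _).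
Qed.

(** One-sided hyperedges and excess gain at most 6 times [(3 * t).+1 * s.+1] per poor vertex, while
    by [n_big] its missing pairs amount to at least 20 times that; so poor vertices drop out. *)
Lemma edge_count : 2 * #|H| + #|missing| <= #|sideA| * #|sideB| + #|doubled|.
Proof.
have h1 := two_cross_pairs; have h2 := card_mono; have h3 := sum_missing.
have eA := sum_excess nbr_sideA; rewrite -/sideB -[2 * _ * _]mulnA in eA.
have eB := sum_excess nbr_sideB; rewrite /sideB setCK -/sideB -[2 * _ * _]mulnA in eB.
have db : \sum_(x in sideA) \sum_(y in sideB) ((x, y) \in doubled) <= #|doubled|.
  rewrite pair_big_dep /= -sum1_card big_mkcond [leqRHS]big_mkcond /=.
  by apply: leq_sum => -[x y] _ /=; case: ifP => //; case: (_ \in doubled).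
have : \sum_(x in sideA) \sum_(y in sideB) (codeg x y + ~~ adj x y) <=
   \sum_(x in sideA) \sum_(y in sideB) (1 + (1 < codeg x y) *
     (excess sideA x y + excess sideB y x) + ((x, y) \in doubled)).
  by apply: leq_sum => x xA; apply: leq_sum => y yB; exact: codeg_split.
under eq_bigr do rewrite big_split.
under [leqRHS]eq_bigr => x _.
  rewrite big_split big_split /=.
  under [X in _ + X + _]eq_bigr do rewrite mulnDr.
  rewrite big_split sum1_card /=.
  over.
rewrite !big_split sum_nat_const /=.
rewrite [X in _ + (_ + X) + _]exchange_big /=.
under [X in _ + (_ + X) + _]eq_bigr do under eq_bigr do rewrite codeg_sym.
have := leq_mul (leqnn #|poor|) n_big; rewrite -/s.
have : #|poor| * (s.+1 * (3 * t)) <= #|poor| * ((3 * t).+1 * s.+1).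
  by rewrite leq_mul2l mulnC leq_mul2r leqnSn !orbT.
have -> : 2000 * (3 * t).+1 * (3 * m + 6 * t).+1 = 2000 * ((3 * t).+1 * s.+1).
  by rewrite mulnA.
move: ((3 * t).+1 * s.+1) (s.+1 * (3 * t)) h2 eA eB => c d h2 eA eB.
rewrite mulnCA; move: (#|poor| * c) (#|poor| * d) h2 eA eB => pc pd.
move: h1 h3 db.
move: (\sum_(x in sideA) \sum_(y in sideB) codeg x y) => S.
move: (\sum_(x in sideA) \sum_(y in sideB) nat_of_bool (~~ adj x y)) => N.
move: (\sum_(x in sideA) \sum_(y in sideB) nat_of_bool ((x, y) \in doubled)) => M.
move: (\sum_(x in sideA) _) (\sum_(x in sideB) _) => S1 S2.
move: (#|poor| * #|V|) (#|sideA| * #|sideB|) #|mono| #|missing| #|doubled| => pV AB mo mi db.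
by move: #|H| => h; clear; lia.
Qed.

Lemma full_disjoint : [disjoint fullA & fullB].
Proof.
rewrite -setI_eq0; apply/eqP/setP => x; rewrite in_set0; apply/negP => /setIP[xA xB].
have := subsetP fullA_sideA _ xA.
have := subsetP fullB_sideB _ xB.
by rewrite inE => /negP.
Qed.

(** Otherwise nearly all of both cores is unmated. An adjacent unmated cross pair needs a poor third
    vertex, since a full one would be a mate; this allows at most m(3t+1)n adjacent pairs, far fewer
    than the cores have. *)
Lemma mated_big : 3600 * t ^ 2 <= n ->
  36 * t ^ 2 <= #|mated H fullA| \/ 36 * t ^ 2 <= #|mated H fullB|.
Proof.
move=> n_big2; set MA := mated H fullA; set MB := mated H fullB; set r := 36 * t ^ 2.
case: (leqP r #|MA|) => [|rA]; first by left.
case: (leqP r #|MB|) => [|rB]; first by right.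
exfalso.
have rn : 100 * r <= n by rewrite /r mulnA.
have A0F := A0_fullA; have B0F := B0_fullB.
pose UA := A0 :\: MA; pose UB := B0 :\: MB.
have cU (X Y : {set V}) : #|X| <= #|X :\: Y| + #|Y|.
  by rewrite -(cardsID Y X) addnC leq_add2l subset_leq_card // subsetIr.
have cUA := cU A0 MA; have cUB := cU B0 MB; rewrite -/UA in cUA; rewrite -/UB in cUB.
have inc x : x \in UA -> #|UB| <= m + #|[set y in UB | adj x y]|.
  move=> /setDP[xA _]; apply: leq_trans (leq_add (A0_miss xA) (leqnn _)).
  apply: leq_trans (leq_card_setU _ _); apply/subset_leq_card/subsetP => y yU.
  have /setDP[yB _] := yU; rewrite in_setU in_setD [y \in nbr x]inE yB [y \in [set _ in _ | _]]inE yU /=.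
  by case: (adj x y).
have low : #|UA| * #|UB| <= #|UA| * m + \sum_(x in UA) #|[set y in UB | adj x y]|.
  by rewrite -!sum_nat_const -big_split; apply: leq_sum => x; exact: inc.
have up : \sum_(x in UA) #|[set y in UB | adj x y]| <= m * ((3 * t).+1 * n).
  apply: (@leq_trans (\sum_(x in UA) \sum_(z in poor) #|[set y in setT | T z x y]|)).
    apply: leq_sum => x xU; have /setDP[xA xM] := xU.
    apply: (@leq_trans (\sum_(z in poor) \sum_(y in setT) T z x y)); last first.
      by rewrite sum_pair_card; apply: leq_sum => z _.
    rewrite exchange_big -sum1_card big_mkcond [leqRHS]big_mkcond /=.
    apply: leq_sum => y _; rewrite in_setT inE; case: (boolP (y \in UB)) => //= yU.
    have /setDP[yB yM] := yU; case: (boolP (adj x y)) => // /existsP[z xyz].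
    have zp : z \in poor.
      rewrite in_setC in_setU negb_or; apply/andP; split.
        apply: contra xM => zF; rewrite inE (subsetP A0F _ xA); apply/exists_inP.
        by exists z => //; apply: (@adj_triple _ _ _ _ y); rewrite triple_swap23.
      apply: contra yM => zF; rewrite inE (subsetP B0F _ yB); apply/exists_inP.
      by exists z => //; apply: (@adj_triple _ _ _ _ x); rewrite -triple_rot.
    rewrite (bigD1 z) //= triple_rot xyz; exact: leq_addr.
  rewrite exchange_big; apply: (@leq_trans (\sum_(z in poor) (3 * t).+1 * n)).
    apply: leq_sum => z _; apply: leq_trans (sum_codeg_le H3 noBook t_gt0 _ _ _) _.
    rewrite -[(3 * t).+1]addn1 mulnDl mul1n leq_add ?max_card //.
    by rewrite leq_mul2l max_card orbT.
  rewrite sum_nat_const leq_mul2r; apply/orP; right.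
  exact: poor_le.
have nb := n_big1; have n0 : 0 < n by apply: leq_trans nb.
have UA_big : 31 * n <= 100 * #|UA| by lia.
have UB_big : 31 * n <= 100 * #|UB| by lia.
have h1 := leq_mul UA_big UB_big.
have UAn : #|UA| <= n by exact: max_card.
have h2 : 2000 * (m * ((3 * t).+1 * n)) <= n * n.
  rewrite mulnA (mulnC 2000) -mulnA mulnA; move: n_big; clear; nia.
have h3 : 2000 * (#|UA| * m) <= n * n.
  move: UAn nb; clear; nia.
move: low up h1 h2 h3 n0; clear; nia.
Qed.

Lemma fullA_leaf x x' : x \in fullA -> x' \in fullA -> adj x x' ->
  2 < #|leaf x x' :&: fullB|.
Proof.
move=> xF x'F xx; apply: (@leq_trans #|leaf x x' :&: B0|); last first.
  by apply/subset_leq_card/setIS/B0_fullB.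
have := full_leaf B0 H3 noBook t_gt0 xx; have := n_big1.
by move: xF x'F B0_big; rewrite !inE; clear; lia.
Qed.

Lemma fullB_leaf y y' : y \in fullB -> y' \in fullB -> adj y y' ->
  2 < #|leaf y y' :&: fullA|.
Proof.
move=> yF y'F yy; apply: (@leq_trans #|leaf y y' :&: A0|); last first.
  by apply/subset_leq_card/setIS/A0_fullA.
have := full_leaf A0 H3 noBook t_gt0 yy; have := n_big1.
by move: yF y'F A0_big; rewrite !inE; clear; lia.
Qed.

(** [card_doubled_bound] asks for many mated vertices on its second side; if only the first side has
    them, the sides are exchanged. *)
Lemma doubled_le : 3600 * t ^ 2 <= n ->
  #|doubled| <= #|missing| + 2 * (t - 1) ^ 2.
Proof.
case/mated_big => big; last first.
  exact: (card_doubled_bound H3 noBook t_gt0 full_disjoint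
    fullA_matching fullB_matching fullA_leaf big).
have -> : #|doubled| = #|doubled_pairs H fullB fullA|.
  apply: card_swapped => x y; rewrite ![_ \in doubled_pairs _ _ _]inE /=.
  by rewrite andbCA [matched _ _ _ && _]andbC.
have -> : #|missing| = #|missing_pairs H fullB fullA|.
  apply: card_swapped => x y; rewrite ![_ \in missing_pairs _ _ _]inE /=.
  by rewrite andbCA adj_sym.
apply: (card_doubled_bound H3 noBook t_gt0 _
    fullB_matching fullA_matching fullB_leaf big).
by rewrite disjoint_sym full_disjoint.
Qed.

Lemma near_bipartite_bound : 3600 * t ^ 2 <= n ->
  #|H| <= n ^ 2 %/ 8 + (if t == 2 then 0 else (t - 1) ^ 2).
Proof.
move=> nt; set c := if _ then _ else _.
have db : #|doubled| <= #|missing| + 2 * c.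
  rewrite /c; case: eqP => t2; last exact: doubled_le.
  rewrite addn0; exact: (doubled_le_missing H3 noBook full_disjoint
    fullA_matching fullB_matching fullA_leaf fullB_leaf t2).
have [agm _] := nat_AGM2 #|sideA| #|sideB|.
have cAB : #|sideA| + #|sideB| = n by rewrite cardsC.
rewrite cAB in agm; rewrite addnC -leq_subLR leq_divRL //.
by move: edge_count db agm; clear; lia.
Qed.

End Counting.

Lemma book_free_bound (t : nat) : 0 < t -> exists n0 : nat,
  forall (V : finType) (H : {set {set V}}), n0 <= #|V| ->
  (forall h, h \in H -> #|h| = 3) -> ~ has_book H t ->
  #|H| <= #|V| ^ 2 %/ 8 + (if t == 2 then 0 else (t - 1) ^ 2).
Proof.
move=> t0; set c := (3 * t).+1.
(* With m = n/Q rounded down, the term 3m of [n_big] takes at most n/2; the threshold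
   [4000 * c * (6 * t).+1] provides for the rest. *)
have [Q QE] : exists Q, Q = 6 * (2000 * c) by eexists.
have [D DE] : exists D, D = 1000 * Q ^ 2 by eexists.
have [n0 few] := few_triangles (3 * t) (8 * D).
exists (n0 + 8 * D * c + 4000 * c * (6 * t).+1 + 3600 * t ^ 2) => V H nV H3 noBook.
have Q0 : 0 < Q by rewrite QE.
case: (ltnP (8 * #|H|) (#|V| ^ 2)) => [small|large].
  by apply: leq_trans (leq_addr _ _); rewrite leq_divRL // mulnC ltnW.
have hbad : 8 * D * #|bad_edges H| <= #|V| ^ 2.
  apply: leq_trans (few V (bad_adj H) _ (@bad_adj_sym _ _) (bad_adj_codeg H3 noBook t0)).
    by rewrite leq_mul2l (card_bad_edges H3 t0) orbT.
  by move: nV; rewrite -!addnA; apply: leq_trans; exact: leq_addr.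
have hs : D * #|V| ^ 2 <= 2 * D * deg_sum H + 2 * #|V| ^ 2.
  have h1 := leq_mul (leqnn (2 * D)) (deg_sum_ge H3 t0).
  have h2 := leq_mul (leqnn D) large.
  by move: h1 h2 hbad; clear; lia.
have hn : 8 * D * (3 * t).+1 <= #|V| by move: nV; rewrite -/c; clear; lia.
have [A0 [B0 [dAB hS hA hB [bA bB]]]] := near_bipartition H3 noBook t0 Q0 DE hs hn.
apply: (@near_bipartite_bound V H t H3 noBook t0 A0 B0 (#|V| %/ Q)) => //.
- by rewrite leq_divRL // mulnC.
- by move=> x xA; rewrite leq_divRL // mulnC hA.
- by move=> y yB; rewrite leq_divRL // mulnC hB.
- have h1 : 4000 * c * (6 * t).+1 <= #|V| by move: nV; clear; lia.
  have h2 : #|V| %/ Q * Q <= #|V| by exact: leq_trunc_div.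
  by move: h1 h2; rewrite {2}QE /c; move: (3 * t).+1 (#|V| %/ Q) => d k; clear; lia.
- by move: nV; clear; lia.
Qed.

(** * Extremal numbers *)

Section BergeBook.
Variables (t n : nat) (H : {set {set 'I_n}}).

Local Notation spine0 := (None : book_V t).
Local Notation spine1 := (Some None : book_V t).
Local Notation page i := (Some (Some i) : book_V t).

Lemma book_EP (E : {set book_V t}) : reflect
  [\/ E = [set spine0; spine1], exists i, E = [set spine0; page i]
    | exists i, E = [set spine1; page i]] (E \in book_E t).
Proof.
rewrite /book_E !in_setU in_set1 -orbA; apply: (iffP or3P).
- by case=> [/eqP->|/imsetP[i _ ->]|/imsetP[i _ ->]];
    [constructor 1 | constructor 2; exists i | constructor 3; exists i].
- case=> [->|[i ->]|[i ->]]; first by constructor 1.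
    by constructor 2; apply/imsetP; exists i.
  by constructor 3; apply/imsetP; exists i.
Qed.

Lemma has_book_berge : has_book H t -> berge_contains (book_E t) H.
Proof.
case=> u [v [e [P [f [g [[uv [eH ue ve] pgP [fI gI] fg] cP]]]]]].
pose w (i : 'I_t) : 'I_n := enum_val (cast_ord (esym cP) i).
have wP i : w i \in P by exact: enum_valP.
have wI : injective w by move=> i j /enum_val_inj/cast_ord_inj.
pose phi : {ffun book_V t -> 'I_n} := [ffun x : book_V t =>
  match x with None => u | Some None => v | Some (Some i) => w i end].
(* An edge of the book is recognised by its page; the edge without a page is the spine. *)
pose F : {ffun {set book_V t} -> {set 'I_n}} := [ffun E : {set book_V t} =>
  if [pick i | page i \in E] is Some i then
    if spine0 \in E then f (w i) else g (w i) else e].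
have F0 : F [set spine0; spine1] = e.
  by rewrite ffunE; case: pickP => // i; rewrite !inE.
have F1 i : F [set spine0; page i] = f (w i).
  rewrite ffunE; case: pickP => [j|/(_ i)]; last by rewrite !inE eqxx orbT.
  by rewrite !inE /= => /eqP[->].
have F2 i : F [set spine1; page i] = g (w i).
  rewrite ffunE; case: pickP => [j|/(_ i)]; last by rewrite !inE eqxx orbT.
  by rewrite !inE /= => /eqP[->].
apply/existsP; exists phi; apply/existsP; exists F; apply/and3P; split.
- apply/injectiveP => -[[i|]|] [[j|]|] //; rewrite !ffunE.
  + by move/wI ->.
  + by move=> ew; have [_ /eqP[]] := pgP _ (wP i).
  + by move=> ew; have [/eqP[]] := pgP _ (wP i).
  + by move=> ew; have [_ /eqP[]] := pgP _ (wP j).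
  + by move=> evu; rewrite evu eqxx in uv.
  + by move=> ew; have [/eqP[]] := pgP _ (wP j).
  + by move=> evu; rewrite evu eqxx in uv.
- apply/forall_inP => E1 /book_EP E1P; apply/forall_inP => E2 /book_EP E2P.
  apply/implyP => /eqP; case: E1P => [->|[i ->]|[i ->]]; case: E2P => [->|[j ->]|[j ->]];
    rewrite ?F0 ?F1 ?F2 // => eF; apply/eqP.
  + by have [_ _ _ _ [/eqP[]]] := pgP _ (wP j).
  + by have [_ _ _ _ [_ /eqP[]]] := pgP _ (wP j).
  + by have [_ _ _ _ [/eqP[]]] := pgP _ (wP i).
  + by rewrite (wI _ _ (fI _ _ (wP i) (wP j) eF)).
  + by have := fg _ _ (wP i) (wP j); rewrite eF eqxx.
  + by have [_ _ _ _ [_ /eqP[]]] := pgP _ (wP i).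
  + by have := fg _ _ (wP j) (wP i); rewrite eF eqxx.
  + by rewrite (wI _ _ (gI _ _ (wP i) (wP j) eF)).
- apply/forall_inP => E /book_EP[->|[i ->]|[i ->]]; rewrite ?F0 ?F1 ?F2.
  + by rewrite eH; apply/subsetP => x /imsetP[y + ->]; rewrite !inE => /orP[]/eqP->; rewrite ffunE.
  + have [_ _ [fH uf wf] _ _] := pgP _ (wP i); rewrite fH.
    by apply/subsetP => x /imsetP[y + ->]; rewrite !inE => /orP[]/eqP->; rewrite ffunE.
  + have [_ _ _ [gH vg wg] _] := pgP _ (wP i); rewrite gH.
    by apply/subsetP => x /imsetP[y + ->]; rewrite !inE => /orP[]/eqP->; rewrite ffunE.
Qed.

Lemma berge_has_book : berge_contains (book_E t) H -> has_book H t.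
Proof.
case/existsP => phi /existsP[F /and3P[/injectiveP phiI FI FP]].
have FH E : E \in book_E t -> F E \in H /\ {subset phi @: E <= F E}.
  by move=> EB; have := forall_inP FP E EB => /andP[? /subsetP].
have Finj E1 E2 : E1 \in book_E t -> E2 \in book_E t -> F E1 = F E2 -> E1 = E2.
  move=> h1 h2 e; apply/eqP; have := forall_inP (forall_inP FI _ h1) _ h2.
  by rewrite e eqxx.
pose u := phi spine0; pose v := phi spine1; pose w i := phi (page i).
have wI : injective w by move=> i j /phiI[].
pose f x := if [pick i | w i == x] is Some i then F [set spine0; page i] else set0.
pose g x := if [pick i | w i == x] is Some i then F [set spine1; page i] else set0.
have fw i : f (w i) = F [set spine0; page i].
  by rewrite /f; case: pickP => [j /eqP/wI->//|/(_ i)]; rewrite eqxx.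
have gw i : g (w i) = F [set spine1; page i].
  by rewrite /g; case: pickP => [j /eqP/wI->//|/(_ i)]; rewrite eqxx.
have E0 : [set spine0; spine1] \in book_E t by apply/book_EP; constructor 1.
have E1 i : [set spine0; page i] \in book_E t by apply/book_EP; constructor 2; exists i.
have E2 i : [set spine1; page i] \in book_E t by apply/book_EP; constructor 3; exists i.
have mem_F (E : {set book_V t}) x : x \in E -> E \in book_E t -> phi x \in F E.
  by move=> xE EB; have [_] := FH _ EB; apply; exact: imset_f.
have neq (E E' : {set book_V t}) x : x \in E -> x \notin E' -> E \in book_E t ->
    E' \in book_E t -> F E != F E'.
  move=> xE xE' h h'; apply/eqP => /(Finj _ _ h h') e.
  by rewrite -e xE in xE'.
exists u, v, (F [set spine0; spine1]), [set w i | i : 'I_t], f, g; split; last first.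
  by rewrite card_imset // card_ord.
split.
- by apply/eqP => /phiI.
- by split; [case: (FH _ E0) | apply: (mem_F _ _ _ E0) | apply: (mem_F _ _ _ E0)];
      rewrite // !inE eqxx ?orbT.
- move=> _ /imsetP[i _ ->]; rewrite fw gw; split.
  + by apply/eqP => /phiI.
  + by apply/eqP => /phiI.
  + by split; [case: (FH _ (E1 i)) | apply: (mem_F _ _ _ (E1 i)) | apply: (mem_F _ _ _ (E1 i))];
      rewrite // !inE eqxx ?orbT.
  + by split; [case: (FH _ (E2 i)) | apply: (mem_F _ _ _ (E2 i)) | apply: (mem_F _ _ _ (E2 i))];
      rewrite // !inE eqxx ?orbT.
  + by split; [apply: (neq _ _ (page i) _ _ (E1 i) E0) | apply: (neq _ _ (page i) _ _ (E2 i) E0)];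
      rewrite !inE ?eqxx ?orbT.
- split=> _ _ /imsetP[i _ ->] /imsetP[j _ ->]; rewrite ?fw ?gw => e; congr w; apply/eqP.
  + have /setP/(_ (page i)) := Finj _ _ (E1 i) (E1 j) e.
    by rewrite !inE eqxx /= => /esym/eqP[->].
  + have /setP/(_ (page i)) := Finj _ _ (E2 i) (E2 j) e.
    by rewrite !inE eqxx /= => /esym/eqP[->].
- move=> _ _ /imsetP[i _ ->] /imsetP[j _ ->]; rewrite fw gw.
  by apply: (neq _ _ spine0 _ _ (E1 i) (E2 j)); rewrite !inE.
Qed.
End BergeBook.

(** * The extremal construction *)

Section Construction.
Variables (V : finType) (A1 P Z B BL B0 : {set V}) (m : V -> V).
Hypothesis dA1P : [disjoint A1 & P].
Hypothesis dA1B : [disjoint A1 & B].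
Hypothesis dPB : [disjoint P & B].
Hypothesis mP : {in P, forall x, [/\ m x \in P, m (m x) = x & (m x \in Z) = (x \notin Z)]}.
Hypothesis mB : {in B, forall y, [/\ m y \in B, m (m y) = y & (m y \in BL) = (y \notin BL)]}.
Hypothesis mB0 : {in B0, forall y, m y \in B0}.
Hypothesis ZP : Z \subset P.
Hypothesis BLB : BL \subset B.
Hypothesis B0B : B0 \subset B.

(* [m] matches [B] and [P] perfectly, [BL] and [Z] contain one vertex of each
   matched pair, and the pairs in [B0] and [P] span the blocks with three
   hyperedges. *)
Definition centred : {set V * V} := setX A1 BL :|: setX Z (B0 :&: BL).
Definition base_pair (p : V * V) : {set V} := [set p.1; p.2; m p.2].
Definition top_pair (p : V * V) : {set V} := [set p.1; m p.1; p.2].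
Definition construction : {set {set V}} :=
  base_pair @: centred :|: top_pair @: setX Z B.

Lemma mB_neq y : y \in B -> m y != y.
Proof.
by move=> yB; have [_ _ e] := mB yB; apply/eqP => e'; move: e; rewrite e'; case: (_ \in _).
Qed.

Lemma mP_neq x : x \in P -> m x != x.
Proof.
by move=> xP; have [_ _ e] := mP xP; apply/eqP => e'; move: e; rewrite e'; case: (_ \in _).
Qed.

Lemma notB x : x \in A1 :|: P -> x \notin B.
Proof.
by rewrite in_setU => /orP[/(disjointFr dA1B)|/(disjointFr dPB)] ->.
Qed.

Lemma constructionP h : h \in construction ->
  (exists x y, [/\ h = [set x; y; m y], x \notin B, y \in B
    & x \in A1 \/ x \in Z /\ y \in B0]) \/
  (exists x y, [/\ h = [set x; m x; y], x \in P, m x \in P, x \notin B /\ m x \notin B & y \in B]).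
Proof.
rewrite in_setU => /orP[/imsetP[[x y] + ->]|/imsetP[[x y] + ->]].
- rewrite in_setU => /orP[/setXP[/= xA yB]|/setXP[/= xZ /setIP[yB0 yB]]]; left; exists x, y.
  + by split=> //; [rewrite notB // in_setU xA | apply: subsetP yB | left].
  + split=> //; [|exact: subsetP yB|by right].
    by rewrite notB // in_setU (subsetP ZP) ?orbT.
- move=> /setXP[/= /(subsetP ZP) xP yB]; right; exists x, y.
  have [mxP _ _] := mP xP; split=> //.
  by split; rewrite notB // in_setU ?xP ?mxP orbT.
Qed.

Lemma top_top h u v : h \in construction -> u \in h -> v \in h -> u != v ->
  u \notin B -> v \notin B -> v = m u /\ u \in P.
Proof.
case/constructionP => [[x [y [-> xB yB _]]]|[x [y [-> xP mxP [xB mxB] yB]]]];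
  rewrite !inE -!orbA => uh vh uv uB vB.
- have [myB _ _] := mB yB.
  have ux z : z \notin B -> [|| z == x, z == y | z == m y] -> z = x.
    move=> zB /or3P[] /eqP // e; last by rewrite e myB in zB.
    by rewrite e yB in zB.
  by move: uv; rewrite (ux u) // (ux v) // eqxx.
- have [_ mmx _] := mP xP.
  case/or3P: uh => /eqP eu; last by rewrite eu yB in uB.
    case/or3P: vh => /eqP ev; last by rewrite ev yB in vB.
      by rewrite eu ev eqxx in uv.
    by rewrite eu ev.
  case/or3P: vh => /eqP ev; last by rewrite ev yB in vB.
    by rewrite eu ev mmx.
  by rewrite eu ev eqxx in uv.
Qed.

Lemma base_base h u v : h \in construction -> u \in h -> v \in h -> u != v ->
  u \in B -> v \in B -> v = m u.
Proof.
case/constructionP => [[x [y [-> xB yB _]]]|[x [y [-> xP mxP [xB mxB] yB]]]];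
  rewrite !inE -!orbA => uh vh uv uB vB.
- have [myB mmy _] := mB yB.
  case/or3P: uh => /eqP eu; first by rewrite -eu uB in xB.
    case/or3P: vh => /eqP ev; first by rewrite -ev vB in xB.
      by rewrite eu ev eqxx in uv.
    by rewrite eu ev.
  case/or3P: vh => /eqP ev; first by rewrite -ev vB in xB.
    by rewrite eu ev mmy.
  by rewrite eu ev eqxx in uv.
- have ux z : z \in B -> [|| z == x, z == m x | z == y] -> z = y.
    move=> zB /or3P[] /eqP // e; first by rewrite -e zB in xB.
    by rewrite -e zB in mxB.
  by move: uv; rewrite (ux u) // (ux v) // eqxx.
Qed.

Lemma top_base h u v : h \in construction -> u \in h -> v \in h ->
  u \notin B -> v \in B ->
  (h = [set u; v; m v] /\ (u \in A1 \/ u \in Z /\ v \in B0)) \/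
  (h = [set u; m u; v] /\ u \in P).
Proof.
case/constructionP => [[x [y [-> xB yB side]]]|[x [y [-> xP mxP [xB mxB] yB]]]];
  rewrite !inE -!orbA => uh vh uB vB.
- have [myB mmy _] := mB yB; left.
  have ux : u = x.
    case/or3P: uh => /eqP // e; last by rewrite e myB in uB.
    by rewrite e yB in uB.
  rewrite ux; case/or3P: vh => /eqP ev; first by rewrite -ev vB in xB.
    by rewrite ev.
  rewrite ev mmy setUAC; split=> //; case: side => [|[xZ yB0]]; [by left | right].
  by split=> //; exact: mB0.
- have [_ mmx _] := mP xP; right.
  have vy : v = y.
    case/or3P: vh => /eqP // e; first by rewrite -e vB in xB.
    by rewrite -e vB in mxB.
  rewrite vy; case/or3P: uh => /eqP eu; last by rewrite eu yB in uB.
    by rewrite eu.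
  by rewrite eu mmx (setUC [set m x]).
Qed.

Lemma construction_card3 h : h \in construction -> #|h| = 3.
Proof.
have c3 (a b c : V) : a != b -> a != c -> b != c -> #|[set a; b; c]| = 3.
  move=> ab ac bc; rewrite setUC cardsU1 cards2 ab !inE.
  by rewrite eq_sym (negPf ac) eq_sym (negPf bc).
have neq x y : x \notin B -> y \in B -> x != y by move=> xB; apply: contraTneq => <-.
case/constructionP => [[x [y [-> xB yB _]]]|[x [y [-> xP mxP [xB mxB] yB]]]].
- have [myB _ _] := mB yB; by apply: c3; [exact: neq | exact: neq | rewrite eq_sym mB_neq].
- by apply: c3; [rewrite eq_sym mP_neq | exact: neq | exact: neq].
Qed.

Variable t : nat.
Hypothesis B0_small : #|B0| <= 2 * (t - 1).
Hypothesis P_small : #|P| <= 2 * (t - 1).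
Hypothesis t_ge2 : 2 <= t.
Hypothesis t2P : 3 <= t \/ P = set0.

Lemma pages_injm (X Y : {set V}) : X \subset Y -> {in Y, forall y, m y \in Y /\ m (m y) = y} ->
  {in X, forall x, m x \notin X} -> 2 * #|X| <= #|Y|.
Proof.
move=> /subsetP XY mY mX.
have inj : {in X &, injective m}.
  by move=> a b /XY/mY[_ ea] /XY/mY[_ eb] e; rewrite -ea e eb.
rewrite mul2n -addnn -{2}(card_in_imset inj).
rewrite -cardsUI [_ :&: _](_ : _ = set0); last first.
  apply/setP => y; rewrite in_set0; apply/negP => /setIP[yX /imsetP[x xX e]].
  by have := mX _ xX; rewrite -e yX.
rewrite cards0 addn0; apply/subset_leq_card/subsetP => y.
rewrite in_setU => /orP[/XY//|/imsetP[x /XY/mY[mxY _] ->]//].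
Qed.

(** Only [m v] and [m u] can be pages on a spine between top and base, the latter only if [P] is
    nonempty, and then t is at least 3. *)
Lemma pages_top_base u v e X f g : book_pages construction u v e X f g ->
  u \notin B -> v \in B -> #|X| < t.
Proof.
move=> [uv [eH ue ve] pg _ _] uB vB.
have Xsub : X \subset [set m v] :|: (if P == set0 then set0 else [set m u]).
  apply/subsetP => w /pg[wu wv [fH uf wf] [gH vg wg] _]; rewrite in_setU in_set1.
  case: (boolP (w \in B)) => wB.
    by rewrite (base_base gH vg wg) ?eqxx // eq_sym.
  have [|-> uP] := top_top fH uf wf _ uB wB; first by rewrite eq_sym.
  by rewrite orbC; case: eqP => [P0|_]; [rewrite P0 inE in uP | rewrite inE eqxx].
apply: leq_ltn_trans (subset_leq_card Xsub) _; apply: leq_ltn_trans (leq_card_setU _ _) _.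
rewrite cards1; case: eqP => [_|P0]; rewrite ?cards0 ?cards1 //.
by case: t2P.
Qed.

Lemma book_pages_sym (H : {set {set V}}) u v e X f g :
  book_pages H u v e X f g -> book_pages H v u e X g f.
Proof.
move=> [uv [eH ue ve] pg [fI gI] fg]; split=> //; first by rewrite eq_sym.
- by move=> w /pg[wu wv fh gh [fe ge]].
- by move=> w w' wX w'X; rewrite eq_sym fg.
Qed.

(** A spine inside the top or the base is a matched pair. Its pages lie in [B0] or in [P]
    respectively, and no page has its partner as another page, which leaves at most t-1 of them. *)
Lemma construction_no_book : ~ has_book construction t.
Proof.
case=> u [v [e [X [f [g [bk cX]]]]]]; have [uv [eH ue ve] pg [fI gI] fg] := bk.
case: (boolP (u \in B)) => uB; case: (boolP (v \in B)) => vB; last first.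
- have [vE uP] := top_top eH ue ve uv uB vB; have [_ mmu mZ] := mP uP.
  have vP : v \in P by rewrite vE; have [] := mP uP.
  have XB w : w \in X -> w \in B.
    move=> wX; have [wu wv [fH uf wf] _ _] := pg w wX.
    apply/negPn/negP => wB; have [|ew _] := top_top fH uf wf _ uB wB.
      by rewrite eq_sym.
    by rewrite ew -vE eqxx in wv.
  have notA1 z : z \in P -> z \in A1 -> False.
    by move=> zP zA; rewrite (disjointFr dA1P zA) in zP.
  (* The end in [Z] is the one with hyperedges through [w] and [m w], and [c w] is this hyperedge,
     the same for both. *)
  pose c w := if u \in Z then f w else g w.
  have cI : {in X &, injective c} by rewrite /c; case: (u \in Z).
  have cP w : w \in X -> w \in B0 /\ c w = [set if u \in Z then u else v; w; m w].
    move=> wX; have wB := XB w wX; have [wu wv [fH uf wf] [gH vg wg] _] := pg w wX.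
    have fgw := fg _ _ wX wX.
    have tf := top_base fH uf wf uB wB; have tg := top_base gH vg wg vB wB.
    have Zv : (v \in Z) = (u \notin Z) by rewrite vE.
    rewrite /c; case: ifP => uZ; rewrite uZ /= in Zv.
    - case: tg => [[_ [/(notA1 _ vP)//|[]]]|[gE _]]; first by rewrite Zv.
      case: tf => [[-> [/(notA1 _ uP)//|[]//]]|[fE _]].
      by move: fgw; rewrite fE gE vE mmu (setUC [set u]) eqxx.
    - case: tf => [[_ [/(notA1 _ uP)//|[]]]|[fE _]]; first by rewrite uZ.
      case: tg => [[-> [/(notA1 _ vP)//|[]//]]|[gE _]].
      by move: fgw; rewrite fE gE vE mmu (setUC [set u]) eqxx.
  have := @pages_injm X B0; rewrite cX => h.
  have : 2 * t <= #|B0|.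
    apply: h.
    + by apply/subsetP => w /cP[].
    + by move=> w wB0; rewrite mB0 //; have [] := mB (subsetP B0B _ wB0).
    + move=> w wX; apply/negP => mwX; have wB := XB _ wX.
      have [_ mmw _] := mB wB; have [_ e1] := cP _ wX; have [_ e2] := cP _ mwX.
      have : w = m w by apply: cI => //; rewrite e1 e2 mmw setUAC.
      by move/esym/eqP; apply/negP; exact: mB_neq.
  by move=> /leq_trans/(_ B0_small); move: t_ge2; clear; lia.
- by have := pages_top_base bk uB vB; rewrite cX ltnn.
- by have := pages_top_base (book_pages_sym bk) vB uB; rewrite cX ltnn.
- have vE := base_base eH ue ve uv uB vB; have [_ mmu _] := mB uB.
  have XnB w : w \in X -> w \notin B.
    move=> wX; have [wu wv [fH uf wf] _ _] := pg w wX.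
    apply/negP => wB; have ew := base_base fH uf wf ltac:(by rewrite eq_sym) uB wB.
    by rewrite ew -vE eqxx in wv.
  have XP w : w \in X -> [/\ w \in P, f w = [set w; u; v] /\ w \in Z \/ f w = [set w; m w; u]
      & g w = [set w; u; v] /\ w \in Z \/ g w = [set w; m w; v]].
    move=> wX; have wB := XnB w wX; have [wu wv [fH uf wf] [gH vg wg] _] := pg w wX.
    have fgw := fg _ _ wX wX.
    have tf := top_base fH wf uf wB uB; have tg := top_base gH wg vg wB vB.
    have wuv : [set w; v; m v] = [set w; u; v] by rewrite vE mmu setUAC.
    rewrite -vE in tf; rewrite wuv in tg.
    case: tf => [[fE [wA|[wZ _]]]|[fE wP]].
    + case: tg => [[gE _]|[gE wP]]; first by rewrite fE gE eqxx in fgw.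
      by rewrite (disjointFr dA1P wA) in wP.
    + case: tg => [[gE _]|[gE wP]]; first by rewrite fE gE eqxx in fgw.
      by split=> //; [left | right].
    + split=> //; first by right.
      case: tg => [[gE [wA|[wZ _]]]|[gE _]]; last by right.
        by rewrite (disjointFr dA1P wA) in wP.
      by left.
  have : 2 * #|X| <= #|P|.
    apply: pages_injm.
    + by apply/subsetP => w /XP[].
    + by move=> w /mP[].
    (* A page outside [Z] uses both hyperedges through [w] and [m w], which leaves its partner only
       the one through [u] and [v]. *)
    + have wlog_claim w : w \in X -> m w \in X -> w \notin Z -> False.
        move=> wX mwX wZ; have [wP f1 g1] := XP _ wX; have [_ f2 g2] := XP _ mwX.
        have [_ mmw _] := mP wP; have nmw := mP_neq wP.
        case: f1 => [[_ wZ']|f1]; first by rewrite wZ' in wZ.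
        case: g1 => [[_ wZ']|g1]; first by rewrite wZ' in wZ.
        rewrite mmw (setUC [set m w] [set w]) in f2 g2.
        case: f2 => [[f2 _]|f2].
          case: g2 => [[g2 _]|g2].
            by have := fg _ _ mwX mwX; rewrite f2 g2 eqxx.
          have e' : w = m w by apply: gI => //; rewrite g1 g2.
          by rewrite -e' eqxx in nmw.
        have e' : w = m w by apply: fI => //; rewrite f1 f2.
        by rewrite -e' eqxx in nmw.
      move=> w wX; apply/negP => mwX; case: (boolP (w \in Z)) => wZ; last exact: wlog_claim wZ.
      have [wP _ _] := XP _ wX; have [_ mmw mZ] := mP wP.
      by apply: (wlog_claim (m w)); rewrite ?mmw ?mZ ?wZ.
  by rewrite cX => /leq_trans/(_ P_small); move: t_ge2; clear; lia.
Qed.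

(** [BL] and [Z] hold one vertex per pair, so neither map repeats a hyperedge; the two kinds differ
    in having two or one vertices in [B]. *)
Lemma card_construction :
  #|A1| * #|BL| + #|Z| * #|B0 :&: BL| + #|Z| * #|B| <= #|construction|.
Proof.
have neq x y : x \notin B -> y \in B -> (x == y = false) * (y == x = false).
  by move=> xB yB; rewrite [y == x]eq_sym; split; apply/negbTE; apply: contraTneq yB => <-.
have cP p : p \in centred -> p.1 \notin B /\ p.2 \in BL.
  case: p => x y; rewrite in_setU => /orP[] /setXP[/= xA].
    by move=> ->; rewrite notB // in_setU xA.
  by case/setIP => _ ->; rewrite notB // in_setU (subsetP ZP) ?orbT.
have I1 : {in centred &, injective base_pair}.
  move=> [x y] [x' y'] /cP[/= xB yL] /cP[/= x'B y'L] e.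
  have yB := subsetP BLB _ yL; have y'B := subsetP BLB _ y'L.
  have [myB mmy mL] := mB yB; have [my'B _ mL'] := mB y'B.
  have ex : x = x'.
    have : x \in base_pair (x', y') by rewrite -e !inE eqxx.
    by rewrite !inE (neq x y') // (neq x (m y')) // !orbF => /eqP.
  have : y \in base_pair (x', y') by rewrite -e !inE eqxx orbT.
  rewrite !inE (neq x' y) //= => /orP[/eqP->|/eqP e']; first by rewrite ex.
  by rewrite e' mL' y'L in yL.
have I2 : {in setX Z B &, injective top_pair}.
  move=> [x y] [x' y'] /setXP[/= xZ yB] /setXP[/= x'Z y'B] e.
  have xP := subsetP ZP _ xZ; have x'P := subsetP ZP _ x'Z.
  have [mxP _ mZ] := mP xP; have [mx'P _ mZ'] := mP x'P.
  have PB z : z \in P -> z \notin B by move=> zP; rewrite notB // in_setU zP orbT.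
  have ey : y = y'.
    have : y \in top_pair (x', y') by rewrite -e !inE eqxx orbT.
    by rewrite !inE (neq x' y) ?PB // (neq (m x') y) ?PB // => /eqP.
  have : x \in top_pair (x', y') by rewrite -e !inE eqxx.
  rewrite !inE (neq x y') ?PB // orbF => /orP[/eqP->|/eqP e']; first by rewrite ey.
  by rewrite e' mZ' x'Z in xZ.
have dis : base_pair @: centred :&: top_pair @: setX Z B = set0.
  apply/setP => h; rewrite in_set0; apply/negP => /setIP[/imsetP[[x y] /cP[/= xB yL] ->]].
  case/imsetP => [[x' y'] /setXP[/= /(subsetP ZP) x'P y'B] e].
  have yB := subsetP BLB _ yL; have [myB _ _] := mB yB.
  have [mx'P _ _] := mP x'P.
  have x'B : x' \notin B by rewrite notB // in_setU x'P orbT.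
  have mx'B : m x' \notin B by rewrite notB // in_setU mx'P orbT.
  have e1 : y = y'.
    have : y \in top_pair (x', y') by rewrite -e !inE eqxx orbT.
    by rewrite !inE (neq x') // (neq (m x')) //= => /eqP.
  have e2 : m y = y'.
    have : m y \in top_pair (x', y') by rewrite -e !inE eqxx orbT.
    by rewrite !inE (neq x') // (neq (m x')) //= => /eqP.
  by have := mB_neq yB; rewrite e2 e1 eqxx.
have dX : setX A1 BL :&: setX Z (B0 :&: BL) = set0.
  apply/setP => -[x y]; rewrite in_set0; apply/negP => /setIP[/setXP[xA _] /setXP[xZ _]].
  by have := subsetP ZP _ xZ; rewrite (disjointFr dA1P xA).
rewrite /construction cardsU dis cards0 subn0 (card_in_imset I1) (card_in_imset I2).
by rewrite /centred cardsU dX cards0 subn0 !cardsX.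
Qed.

End Construction.

Lemma card_ord_ltn n k : k <= n -> #|[set x : 'I_n | x < k]| = k.
Proof.
move=> kn; rewrite -sum1_card (eq_bigl (fun x : 'I_n => x < k)); last by move=> x; rewrite inE.
by rewrite -(big_ord_widen n (fun=> 1) kn) sum_nat_const card_ord muln1.
Qed.

Lemma card_ord_even n k : 2 * k <= n -> #|[set x : 'I_n | ~~ odd x & x < 2 * k]| = k.
Proof.
move=> kn; rewrite -sum1_card (eq_bigl (fun x : 'I_n => (~~ odd x) && (x < 2 * k))); last first.
  by move=> x; rewrite inE.
rewrite -(big_ord_widen_cond n (fun x => ~~ odd x) (fun=> 1) kn) big_mkcond /=.
elim: k {kn} => [|k IH]; first by rewrite big_ord0.
rewrite (_ : 2 * k.+1 = (2 * k).+2); last by lia.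
by rewrite !big_ord_recr /= IH mul2n odd_double /= addn0 addn1.
Qed.

(** * The construction on ['I_n] *)

Section Example.
Variables (n b p : nat).
Hypothesis bpn : 2 * b + 2 * p <= n.
Hypothesis pb : p <= b.

(** Vertices 2i and 2i+1 are partners; the fallback of [insubd] concerns a last index without
    successor. *)
Definition partner (x : 'I_n) : 'I_n := insubd x (if odd x then x.-1 else x.+1).
Definition evens (S : {set 'I_n}) : {set 'I_n} := [set x in S | ~~ odd x].
Definition exB : {set 'I_n} := [set x : 'I_n | x < 2 * b].
Definition exP : {set 'I_n} := [set x : 'I_n | 2 * b <= x < 2 * b + 2 * p].
Definition exA : {set 'I_n} := [set x : 'I_n | 2 * b + 2 * p <= x].
Definition exB0 : {set 'I_n} := [set x : 'I_n | x < 2 * p].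

Definition example : {set {set 'I_n}} :=
  construction exA (evens exP) exB (evens exB) exB0 partner.

Lemma partnerE (x : 'I_n) : x < 2 * b + 2 * p ->
  partner x = (if odd x then x.-1 else x.+1) :> nat.
Proof.
move=> xb; rewrite val_insubd; case: ifP => // /negP[].
by have := odd_double_half x; case: ifP => /=; lia.
Qed.

Lemma partner_spec (S : {set 'I_n}) k l : S = [set x : 'I_n | 2 * k <= x < 2 * l] ->
  2 * l <= 2 * b + 2 * p ->
  {in S, forall x, [/\ partner x \in S, partner (partner x) = x &
    (partner x \in evens S) = (x \notin evens S)]}.
Proof.
move=> SE lb x; rewrite SE inE => xkl.
have q1 : partner x = (if odd x then x.-1 else x.+1) :> nat by apply: partnerE; lia.
have xS : partner x \in S.
  by rewrite SE inE q1; have := odd_double_half x; case: ifP => /= _; lia.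
have q2 : partner (partner x) = (if odd (partner x) then (partner x).-1 else (partner x).+1) :> nat.
  by apply: partnerE; move: xS; rewrite SE inE; lia.
have oddq : odd (partner x) = ~~ odd x.
  by rewrite q1; case: (nat_of_ord x) => //= a; case oa: (odd a); rewrite /= ?oa.
rewrite -SE; split=> //; last by rewrite !inE xS oddq SE inE xkl.
apply/val_inj; rewrite /= q2 oddq q1; case: (nat_of_ord x) => //= a.
by case: (odd a).
Qed.

Lemma exP_spec : {in exP, forall x, [/\ partner x \in exP, partner (partner x) = x &
  (partner x \in evens exP) = (x \notin evens exP)]}.
Proof. by apply: (@partner_spec _ b (b + p)); [rewrite mulnDr | rewrite mulnDr]. Qed.

Lemma exB_spec : {in exB, forall x, [/\ partner x \in exB, partner (partner x) = x &
  (partner x \in evens exB) = (x \notin evens exB)]}.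
Proof. by apply: (@partner_spec _ 0 b) => //; exact: leq_addr. Qed.

Lemma exB0_spec : {in exB0, forall x, partner x \in exB0}.
Proof.
move=> x xB; have [] // := @partner_spec exB0 0 p _ _ x xB.
exact: leq_addl.
Qed.

Lemma example_disjoint : [/\ [disjoint exA & exP], [disjoint exA & exB] & [disjoint exP & exB]].
Proof.
by split; rewrite -setI_eq0; apply/eqP/setP => x; rewrite !inE; lia.
Qed.

Lemma evens_sub S : evens S \subset S.
Proof. by apply/subsetP => x /setIdP[]. Qed.

Lemma exB0_sub : exB0 \subset exB.
Proof. by apply/subsetP => x; rewrite !inE; lia. Qed.

Lemma example_card3 h : h \in example -> #|h| = 3.
Proof.
have [d1 d2 d3] := example_disjoint.
exact: (construction_card3 d2 d3 exP_spec exB_spec (evens_sub _) (evens_sub _)).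
Qed.

Lemma card_exP : #|exP| = 2 * p.
Proof.
have -> : exP = [set x : 'I_n | x < 2 * b + 2 * p] :\: exB.
  by apply/setP => x; rewrite !inE; lia.
rewrite cardsD (setIidPr _) ?card_ord_ltn; first by lia.
- by lia.
- by lia.
- by apply/subsetP => x; rewrite !inE; lia.
Qed.

Lemma example_no_book t : p <= t - 1 -> 2 <= t -> (3 <= t \/ p = 0) -> ~ has_book example t.
Proof.
move=> pt t2 tp; have [d1 d2 d3] := example_disjoint.
apply: (construction_no_book d1 d2 d3 exP_spec exB_spec exB0_spec (evens_sub _)
  (evens_sub _) exB0_sub) => //.
- by rewrite card_ord_ltn; lia.
- by rewrite card_exP leq_mul2l pt orbT.
- case: tp => [|p0]; [by left | right].
  by apply/setP => x; rewrite !inE p0; lia.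
Qed.

Lemma card_evens_exB : #|evens exB| = b.
Proof.
rewrite -[RHS](@card_ord_even n); last by lia.
by apply: eq_card => x; rewrite !inE andbC.
Qed.

Lemma card_evens_exP : #|evens exP| = p.
Proof.
have -> : evens exP = [set x : 'I_n | ~~ odd x & x < 2 * (b + p)] :\: evens exB.
  by apply/setP => x; rewrite !inE mulnDr; case: (odd x); rewrite ?andbF ?andbT //=; lia.
rewrite cardsD (setIidPr _) ?card_ord_even ?card_evens_exB; first by lia.
- by rewrite mulnDr.
- by apply/subsetP => x; rewrite !inE; case: (odd x); rewrite ?andbF ?andbT //=; lia.
Qed.

(** Compared with p = 0, the 2p vertices of [P] give up b hyperedges each and their p pairs gain 2b
    each, so the p^2 hyperedges inside blocks are pure surplus. *)
Lemma card_example : (n - 2 * b) * b + p ^ 2 <= #|example|.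
Proof.
have [d1 d2 d3] := example_disjoint.
have := card_construction exB0 d1 d2 d3 exP_spec exB_spec (evens_sub exP) (evens_sub exB).
rewrite -/example card_evens_exB card_evens_exP.
have -> : #|exB0 :&: evens exB| = p.
  rewrite -[RHS](@card_ord_even n); last by lia.
  by apply: eq_card => x; rewrite !inE; case: (odd x); rewrite ?andbF ?andbT //=; lia.
have -> : #|exB| = 2 * b by rewrite card_ord_ltn; lia.
have -> : #|exA| = n - (2 * b + 2 * p).
  rewrite (_ : exA = ~: [set x : 'I_n | x < 2 * b + 2 * p]).
    by rewrite [LHS]cardsCs setCK card_ord card_ord_ltn.
  by apply/setP => x; rewrite !inE; lia.
apply: leq_trans.
have [k ->] : exists k, n = 2 * b + 2 * p + k by exists (n - (2 * b + 2 * p)); lia.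
by rewrite addKn -addnA addKn -mulnn; lia.
Qed.

End Example.

(** [(n + 1) %/ 4] is an integer nearest to n/4, where b(n - 2b) is largest. *)
Lemma balanced_square n : n ^ 2 %/ 8 <= (n - 2 * ((n + 1) %/ 4)) * ((n + 1) %/ 4).
Proof.
rewrite -ltnS ltn_divLR //.
have [k [r [r4 nE]]] : exists k r, r < 4 /\ n + 1 = 4 * k + r.
  by exists ((n + 1) %/ 4), ((n + 1) %% 4); rewrite ltn_mod mulnC -divn_eq.
rewrite nE [4 * k]mulnC divnMDl // divn_small // addn0 -mulnn.
have -> : n - 2 * k = 2 * k + r - 1 by lia.
by case: r r4 nE => [|[|[|[|r]]]] //= _ nE; nia.
Qed.

Theorem theorem3 :
  (exists n0 : nat, forall n : nat, n0 <= n ->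
     ex_berge 3 n (book_E 2) = (n ^ 2) %/ 8) /\
  (forall t : nat, 3 <= t -> exists n0 : nat, forall n : nat, n0 <= n ->
     ex_berge 3 n (book_E t) = (n ^ 2) %/ 8 + (t - 1) ^ 2).
Proof.
(* [p] is the number of pairs on either side that span blocks: 0 for t = 2 and t-1 otherwise. *)
have main t p : 2 <= t -> p <= t - 1 -> (3 <= t \/ p = 0) ->
    (if t == 2 then 0 else (t - 1) ^ 2) = p ^ 2 ->
    exists n0 : nat, forall n : nat, n0 <= n ->
      ex_berge 3 n (book_E t) = (n ^ 2) %/ 8 + p ^ 2.
  move=> t2 pt tp pE; have [n0 ub] := book_free_bound (ltnW t2).
  exists (n0 + 8 * p + 8) => n nn; apply/eqP; rewrite eqn_leq; apply/andP; split.
    apply/bigmax_leqP => H /andP[/forall_inP H3 nb].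
    rewrite -pE; have := ub 'I_n H; rewrite card_ord; apply; first by lia.
      by move=> h /H3/eqP.
    by move/has_book_berge; exact/negP.
  pose b := (n + 1) %/ 4.
  have bpn : 2 * b + 2 * p <= n by rewrite /b; lia.
  have pb : p <= b by rewrite /b; lia.
  apply: leq_trans (leq_trans (card_example bpn pb) _).
    by rewrite leq_add2r balanced_square.
  apply: leq_bigmax_cond; apply/andP; split.
    by apply/forall_inP => h /(example_card3 bpn pb)/eqP.
  by apply/negP => /berge_has_book; apply: example_no_book.
split.
  have [n0 h] := main 2 0 isT isT (or_intror erefl) erefl.
  by exists n0 => n /h ->; rewrite addn0.
move=> t t3; apply: main => //; first exact: ltnW.
  by left.
by case: eqP t3 => // ->.
Qed.
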